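(* $(\mathcal{M},\mathcal{W}^{a,b}_p)$ is a metric space; that is, $\mathcal{W}^{a,b}_p$ takes finite nonnegative values on $\mathcal{M}\times\mathcal{M}$, is symmetric, satisfies the triangle inequality, and for $\mu_0,\mu_1\in\mathcal{M}$ one has $\mathcal{W}^{a,b}_p(\mu_0,\mu_1)=0$ if and only if $\mu_0=\mu_1$.
   Context: Setting. $\mathcal{X}$ is a finite set with $N$ points, $K:\mathcal{X}\times\mathcal{X}\to[0,\infty)$ is an irreducible Markov kernel (row-stochastic matrix), and $\varpi:\mathcal{X}\to[0,\infty)$ is its unique steady-state probability distribution ($\varpi(x)=\sum_{y}\varpi(y)K(y,x)$, $\sum_y\varpi(y)=1$). $\varpi$ is assumed reversible: $K(x,y)\varpi(x)=K(y,x)\varpi(y)$ for all $x,y$. $\mathcal{M}=\{\mu:\mathcal{X}\to\mathbb{R}\mid \mu(x)\ge 0\ \forall x\}$ and $\mathcal{M}_+=\{\mu:\mathcal{X}\to\mathbb{R}\mid\mu(x)>0\ \forall x\}$. For $\psi\in\mathbb{R}^{\mathcal X}$, $\|\psi\|_{\varpi,1}=\sum_x\varpi(x)|\psi(x)|$. Fixed throughout: real numbers $a,b>0$ and $p\in\mathcal{M}_+$ with $\|p\|_{\varpi,1}=1$. Logarithmic mean: for $u,v\ge 0$, $\theta(u,v)=\int_0^1u^{\xi}v^{1-\xi}\,d\xi$, i.e. $\theta(u,u)=u$, $\theta(u,v)=\frac{u-v}{\log u-\log v}$ for $u\ne v$ both positive, and $\theta(u,v)=0$ if $u=0$ or $v=0$.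 For $\mu\in\mathcal{M}$, $\hat\mu(x,y):=\theta(\mu(x),\mu(y))$. Admissible trajectories: for $\mu_0,\mu_1\in\mathcal{M}$, $\mathrm{CE}_p(\mu_0,\mu_1;[0,1])$ is the set of triples $(\mu_t,\psi_t,h_t)_{t\in[0,1]}$ such that $t\mapsto\mu_t\in\mathcal{M}$ is absolutely continuous, $t\mapsto\psi_t\in\mathbb{R}^{\mathcal{X}}$ and $t\mapsto h_t\in\mathbb{R}$ are measurable, for a.e. $t\in[0,1]$ and all $x\in\mathcal{X}$ $$\dot\mu_t(x)+\sum_{y\in\mathcal{X}}(\psi_t(y)-\psi_t(x))\hat\mu_t(x,y)K(x,y)=h_t\,p(x),$$ and $\mu_t|_{t=0}=\mu_0$, $\mu_t|_{t=1}=\mu_1$. Define $$\mathcal{W}^{a,b}_p(\mu_0,\mu_1)^2:=\inf\Big\{a^2\int_0^1h_t^2\,dt+b^2\int_0^1\frac12\sum_{x,y\in\mathcal{X}}(\psi_t(y)-\psi_t(x))^2\hat\mu_t(x,y)K(x,y)\varpi(x)\,dt\Big\},$$ the infimum being over $(\mu_t,\psi_t,h_t)_{t\in[0,1]}\in\mathrm{CE}_p(\mu_0,\mu_1;[0,1])$, and $\mathcal{W}^{a,b}_p(\mu_0,\mu_1)\ge0$ is its square root. *)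

(* Defs.v *)
From HB Require Import structures.
From mathcomp Require Import all_boot all_order all_algebra.
From mathcomp Require Import all_classical all_reals all_analysis.

Set Implicit Arguments.
Unset Strict Implicit.
Unset Printing Implicit Defensive.

Import Order.TTheory GRing.Theory Num.Theory.
Import numFieldNormedType.Exports.

Local Open Scope classical_set_scope.
Local Open Scope ring_scope.

Definition markov_kernel (R : realType) (X : finType) (K : X -> X -> R) : Prop :=
  (forall x y, 0 <= K x y) /\ (forall x, \sum_(y : X) K x y = 1).

Fixpoint kernel_pow (R : realType) (X : finType) (K : X -> X -> R) (n : nat)
    (x y : X) : R :=
  if n is m.+1 then \sum_(z : X) K x z * kernel_pow K m z y else (x == y)%:R.

Definition irreducible_kernel (R : realType) (X : finType) (K : X -> X -> R) :
    Prop :=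
  forall x y, exists n, 0 < kernel_pow K n x y.

Definition steady_state (R : realType) (X : finType) (K : X -> X -> R)
    (w : X -> R) : Prop :=
  [/\ forall x, 0 <= w x,
      forall x, w x = \sum_(y : X) w y * K y x
    & \sum_(y : X) w y = 1].

Definition reversible_for (R : realType) (X : finType) (K : X -> X -> R)
    (w : X -> R) : Prop :=
  forall x y, K x y * w x = K y x * w y.

Definition nonneg_densities (R : realType) (X : finType) : set (X -> R) :=
  [set mu | forall x, 0 <= mu x].

Definition pos_densities (R : realType) (X : finType) : set (X -> R) :=
  [set mu | forall x, 0 < mu x].

Definition weighted_norm1 (R : realType) (X : finType) (w psi : X -> R) : R :=
  \sum_(x : X) w x * `|psi x|.

(* [powR] has 0 `^ 0 = 1 and 0 `^ r = 0 for r != 0, so for u = 0 or v = 0 the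
   integrand vanishes on the open interval ]0, 1[. *)
Definition log_mean (R : realType) (u v : R) : R :=
  (\int[@lebesgue_measure R]_(xi in `[0, 1]) (u `^ xi * v `^ (1 - xi)))%R.

Definition hat (R : realType) (X : finType) (mu : X -> R) (x y : X) : R :=
  log_mean (mu x) (mu y).

Definition abs_continuous_on (R : realType) (c d : R) (f : R -> R) : Prop :=
  forall eps : R, 0 < eps -> exists2 delta : R, 0 < delta &
    forall (n : nat) (s t : 'I_n -> R),
      (forall i, c <= s i /\ s i <= t i /\ t i <= d) ->
      trivIset [set: 'I_n] (fun i => `]s i, t i[%classic) ->
      \sum_(i < n) (t i - s i) < delta ->
      \sum_(i < n) `|f (t i) - f (s i)| < eps.

(* Trajectories are total functions of the time in R; only their restriction to
   [0, 1] matters. The derivative is required at almost every time, hence its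
   two-sidedness at the endpoints is irrelevant. *)
Record CE (R : realType) (X : finType) (K : X -> X -> R) (p mu0 mu1 : X -> R)
    (mu psi : R -> X -> R) (h : R -> R) : Prop := {
  CE_nonneg : forall t, t \in `[0, 1] -> nonneg_densities (mu t) ;
  CE_abs_continuous : forall x, abs_continuous_on 0 1 (fun t => mu t x) ;
  CE_measurable_psi :
    forall x, measurable_fun (`[0, 1] : set R) (fun t => psi t x) ;
  CE_measurable_h : measurable_fun (`[0, 1] : set R) h ;
  CE_equation : {ae @lebesgue_measure R, forall t, t \in `[0, 1] ->
    forall x, derivable (fun s => mu s x) t 1 /\
      derive1 (fun s => mu s x) t
        + \sum_(y : X) (psi t y - psi t x) * hat (mu t) x y * K x y
      = h t * p x} ;
  CE_start : mu 0 = mu0 ;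
  CE_end : mu 1 = mu1
}.

Definition action (R : realType) (X : finType) (K : X -> X -> R) (w : X -> R)
    (a b : R) (mu psi : R -> X -> R) (h : R -> R) : \bar R :=
  ((a ^+ 2)%:E * (\int[@lebesgue_measure R]_(t in `[0%R, 1%R]) (h t ^+ 2)%:E)
   + (b ^+ 2)%:E * (\int[@lebesgue_measure R]_(t in `[0%R, 1%R])
       (2^-1 * \sum_(x : X) \sum_(y : X)
          (psi t y - psi t x) ^+ 2 * hat (mu t) x y * K x y * w x)%:E))%E.

Definition W (R : realType) (X : finType) (K : X -> X -> R) (w : X -> R)
    (a b : R) (p mu0 mu1 : X -> R) : \bar R :=
  sqrte (ereal_inf [set c : \bar R | exists (mu psi : R -> X -> R) (h : R -> R),
    CE K p mu0 mu1 mu psi h /\ c = action K w a b mu psi h]).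

(* Main.v *)
(* Symmetry is time reversal.  For the triangle inequality two paths of actions r1^2 and
   r2^2 are run one after the other on the time fractions r1 / (r1 + r2) and
   r2 / (r1 + r2), which gives the action (r1 + r2)^2.  Finiteness: adding a multiple of p
   through the source alone lifts any density to a positive one, and two positive
   densities are joined by a straight segment, the potential solving at each time a
   Poisson equation whose solution depends continuously on the time.  Separation: by
   reversibility the total mass has derivative h, so a small action keeps the densities
   bounded; then |mu'| <= C (cost / r + r) for every r > 0, hence an action below r^2
   moves mu by at most 2 C r.  The last step integrates a derivative known only almost
   everywhere along an absolutely continuous path. *)

Require Import Defs.
From HB Require Import structures.
From mathcomp Require Import all_boot all_order all_algebra.
From mathcomp Require Import all_classical all_reals all_analysis.
From mathcomp Require Import measurable_realfun ring lra.

Import Order.TTheory GRing.Theory Num.Theory.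
Import numFieldNormedType.Exports.

Set Implicit Arguments.
Unset Strict Implicit.
Unset Printing Implicit Defensive.

Local Open Scope classical_set_scope.
Local Open Scope ring_scope.

(** Separation needs increments bounded only from above: if |f'| <= g almost everywhere, then |f d -
    f c| is at most the integral of g. The obstacle is the null set where the equation may fail, and
    absolute continuity is what controls the path there. The bound |u| <= u^2 / r + r stands in for
    the Cauchy-Schwarz inequality and keeps every estimate linear in the cost. The logarithmic mean
    vanishes with either density, so a straight segment that starts or ends at a vanishing density
    may lose conductances, and with them the control of the potential. Raising both ends by p keeps
    the whole segment positive: the cost is then continuous on the compact interval [0, 1], hence
    bounded. Continuity of the potential is read off Cramer's rule. *)

Definition affine (R : realType) (k m : R) : measurableTypeR R -> measurableTypeR R :=
  fun t => k * t + m.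

Lemma measurable_affine (R : realType) (k m : R) :
  measurable_fun [set: measurableTypeR R] (affine k m).
Proof. by apply: measurable_funD => //; apply: measurable_funM. Qed.

(** * Affine changes of time in Lebesgue integrals and null sets *)

Section affine_change_of_variable.
Context (R : realType).
Implicit Types k m : R.
Local Notation leb := (@lebesgue_measure R).

(** A negative [k], needed for time reversal, moves the closed end of the preimage to the left;
    hence the two cases. *)
Lemma affine_preimage_ocitv k m (u v : R) : k != 0 -> u <= v ->
  (leb (affine k m @^-1` `]u, v]) = (`|k|^-1 * (v - u))%:E)%E.
Proof.
move=> k0 uv; have [k_gt0|k_lt0|k00] := ltgtP 0 k; last by rewrite k00 eqxx in k0.
- rewrite (_ : _ @^-1` _ = `](u - m) / k, (v - m) / k]%classic); last first.
    apply/seteqP; split => x /=; rewrite /affine !in_itv /= ltr_pdivrMr // ler_pdivlMr //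
      ltrBlDr lerBrDr mulrC //.
  rewrite lebesgue_measure_itv /= lte_fin gtr0_norm //.
  case: ltP => h; first by rewrite -EFinB; congr EFin; field.
  have -> : v = u; last by rewrite subrr mulr0.
  apply/eqP; rewrite eq_le uv andbT.
  by move: h; rewrite ler_pM2r ?invr_gt0 // lerBlDr subrK.
- rewrite (_ : _ @^-1` _ = `[(v - m) / k, (u - m) / k[%classic); last first.
    apply/seteqP; split => x /=; rewrite /affine !in_itv /= ltr_ndivlMr // ler_ndivrMr //
      ltrBlDr lerBrDr mulrC andbC //.
  rewrite lebesgue_measure_itv /= lte_fin ltr0_norm //.
  case: ltP => h; first by rewrite -EFinB; congr EFin; field.
  have -> : v = u; last by rewrite subrr mulr0.
  apply/eqP; rewrite eq_le uv andbT.
  by move: h; rewrite ler_nM2r ?invr_lt0 // lerBlDr subrK.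
Qed.

Definition affine_image_measure k m : {measure set (measurableTypeR R) -> \bar R}.
Proof.
unshelve refine (mscale (NngNum (normr_ge0 k)) (pushforward leb (affine k m))).
exact: measurable_affine.
Defined.

(** Lebesgue measure is determined by its values on half-open intervals, and the factor |k| undoes
    the stretching there. *)
Lemma lebesgue_measure_affine k m (A : set (measurableTypeR R)) :
  k != 0 -> measurable A -> leb A = affine_image_measure k m A.
Proof.
move=> k0; apply: lebesgue_measure_unique => _ [[u v]] /= _ <-.
rewrite /mscale /= /pushforward.
have [uv|vu] := leP u v.
  rewrite affine_preimage_ocitv // -EFinM mulrA divff ?normr_eq0 // mul1r.
  rewrite lebesgue_measure_itv /= lte_fin; case: ltP => h; first by rewrite -EFinB.
  by rewrite (@le_anti _ _ u v) ?uv // subrr.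
by rewrite set_itv_ge ?bnd_simp -?leNgt ?(ltW vu) // preimage_set0 !measure0 mule0.
Qed.

Lemma ge0_integral_affine k m (D : set R) (f : R -> \bar R) :
  k != 0 -> measurable D -> measurable_fun D f -> (forall t, D t -> 0 <= f t)%E ->
  (\int[leb]_(t in D) f t =
    `|k|%:E * \int[leb]_(t in affine k m @^-1` D) f (k * t + m)%R)%E.
Proof.
move=> k0 mD mf f0.
rewrite (eq_measure_integral (affine_image_measure k m)); last first.
  by move=> A mA _; exact: lebesgue_measure_affine.
rewrite ge0_integral_mscale //=.
rewrite (ge0_integral_pushforward (measurable_affine k m)) //.
by move=> t /set_mem; exact: f0.
Qed.

Lemma ae_affine k m (P : R -> Prop) : k != 0 ->
  {ae leb, forall t, P t} -> {ae leb, forall t, P (k * t + m)}.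
Proof.
move=> k0 [A [mA A0 PA]].
exists (affine k m @^-1` A); split.
- by rewrite -[X in measurable X]setTI; exact: measurable_affine.
- have := lebesgue_measure_affine m k0 mA.
  rewrite A0 /= /mscale /= /pushforward => /esym/eqP.
  by rewrite mule_eq0 eqe normr_eq0 (negbTE k0) /= => /eqP.
- by move=> t /= Pt; apply: PA.
Qed.

End affine_change_of_variable.

(** * Increments of absolutely continuous functions *)

Section absolute_continuity.
Context (R : realType).
Implicit Types (c d : R) (f g G : R -> R).
Local Notation leb := (@lebesgue_measure R).

(** A form of Cousin's lemma. Points satisfying [P] come arbitrarily close to their supremum from
    the left, and the step at the supremum carries [P] past it unless it is [d]. The step straddles
    [t], which suits derivative estimates based at [t]. *)
Lemma real_induction c d (P : R -> Prop) : c <= d -> P c ->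
  (forall t, c <= t <= d -> exists2 r, 0 < r &
    forall s v, c <= s -> s <= t -> t <= v -> v <= d -> t - s < r -> v - t < r ->
      P s -> P v) ->
  P d.
Proof.
move=> cd Pc step; pose A := [set t | c <= t <= d /\ P t].
have Ac : A c by split => //; rewrite lexx.
have supA : has_sup A.
  by split; [exists c | exists d => t [/andP[]]].
have cT : c <= sup A by apply: ub_le_sup => //; exact: supA.2.
have Td : sup A <= d by apply: ge_sup; [exists c | move=> t [/andP[]]].
have [r r0 Tr] := step (sup A) (introT andP (conj cT Td)).
have [s [/andP[cs sd] Ps] Trs] := sup_adherent r0 supA.
have sT : s <= sup A by apply: ub_le_sup => //; [exact: supA.2 | split => //; rewrite cs].
(* Half of [r] makes [v] exceed the supremum, when there is room, and still lie strictly within the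
   gauge. *)
pose v := Num.min d (sup A + r / 2).
have Tv : sup A <= v by rewrite le_min Td lerDl divr_ge0 // ltW.
have vr : v <= sup A + r / 2 by rewrite ge_min lexx orbT.
have vd : v <= d by rewrite ge_min lexx.
have Pv : P v by apply: (Tr s) => //; lra.
have vT : v <= sup A.
  apply: ub_le_sup; [exact: supA.2 | split => //].
  by rewrite vd (le_trans cT).
suff <- : v = d by [].
by move: vT; rewrite {1}/v ge_min => /orP[dT|]; [apply/eqP; rewrite eq_le vd (le_trans dT) | lra].
Qed.

Lemma derivable_linear_approx f (t eps : R) : derivable f t 1 -> 0 < eps ->
  exists2 r, 0 < r & forall v, `|v - t| < r ->
    `|f v - f t - derive1 f t * (v - t)| <= eps * `|v - t|.
Proof.
move=> /derivable_nbhs/eqaddoP df e0; move: (df eps e0); rewrite -derive1E.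
move=> /nbhs_ballP[r /= r0 ball_r]; exists r => // v vt.
have : ball 0 r (v - t) by rewrite -ball_normE /= sub0r normrN.
move=> /ball_r h.
have {h} : `|f ((v - t) * 1 + t) - (f t + (v - t) * derive1 f t)| <= eps * `|v - t|.
  exact: h.
by rewrite mulr1 subrK opprD addrA [(v - t) * _]mulrC.
Qed.

(** The straddle lemma: both increments are compared with the linear approximation at [t], and the
    errors [eps / 2] of [f] and of [G] add up. *)
Lemma derive1_le_growth f G (t eps : R) : derivable f t 1 -> derivable G t 1 ->
  `|derive1 f t| <= derive1 G t -> 0 < eps ->
  exists2 r, 0 < r & forall s v, s <= t -> t <= v -> t - s < r -> v - t < r ->
    `|f v - f s| <= G v - G s + eps * (v - s).
Proof.
move=> df dG fG e0; have e20 : 0 < eps / 2 by rewrite divr_gt0.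
have [r r0 fr] := derivable_linear_approx df e20.
have [q q0 Gq] := derivable_linear_approx dG e20.
exists (Num.min r q); first by rewrite lt_min r0.
move=> s v st tv; rewrite !lt_min => /andP[tsr tsq] /andP[vtr vtq].
have vs0 : 0 <= v - t by rewrite subr_ge0.
have ts0 : 0 <= t - s by rewrite subr_ge0.
have := fr v; rewrite (ger0_norm vs0) => /(_ vtr); rewrite ler_norml => /andP[f1 f2].
have := Gq v; rewrite (ger0_norm vs0) => /(_ vtq); rewrite ler_norml => /andP[G1 G2].
have := fr s; rewrite distrC (ger0_norm ts0) => /(_ tsr); rewrite ler_norml => /andP[f3 f4].
have := Gq s; rewrite distrC (ger0_norm ts0) => /(_ tsq); rewrite ler_norml => /andP[G3 G4].
move: fG; rewrite ler_norml => /andP[fG1 fG2].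
have h1 := ler_wpM2r vs0 fG1; have h2 := ler_wpM2r vs0 fG2.
have h3 := ler_wpM2r ts0 fG1; have h4 := ler_wpM2r ts0 fG2.
rewrite ler_norml; apply/andP; split; nra.
Qed.

(** Lists replace families over ['I_n] so that an induction can add intervals one by one. They run
    from right to left: a new rightmost interval is added by cons. *)
Lemma abs_continuous_on_seq c d f (eps : R) : abs_continuous_on c d f -> 0 < eps ->
  exists2 delta : R, 0 < delta & forall l : seq (R * R),
    all (fun q => [&& c <= q.1, q.1 <= q.2 & q.2 <= d]) l ->
    pairwise (fun q' q => q.2 <= q'.1) l ->
    \sum_(q <- l) (q.2 - q.1) < delta ->
    \sum_(q <- l) `|f q.2 - f q.1| < eps.
Proof.
move=> fac e0; have [delta d0 H] := fac _ e0; exists delta => // l l_in l_disj.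
rewrite !(big_nth (0, 0)) !big_mkord => l_small.
apply: (H (size l) (fun i => (nth (0, 0) l i).1) (fun i => (nth (0, 0) l i).2)) => //.
  by move=> i; move/all_nthP : l_in => /(_ (0, 0) i (ltn_ord i))/and3P[].
have disj i j : (i < j)%N -> (j < size l)%N -> forall x,
    (nth (0, 0) l i).1 < x < (nth (0, 0) l i).2 ->
    (nth (0, 0) l j).1 < x < (nth (0, 0) l j).2 -> False.
  move=> ij jl x /andP[xi _] /andP[_ xj].
  have /(pairwiseP (0, 0)) /(_ i j (ltn_trans ij jl) jl ij) := l_disj.
  by move=> /(lt_le_trans xj) /(lt_trans xi); rewrite ltxx.
move=> i j _ _ [x [/= xi xj]]; rewrite !in_itv /= in xi xj.
apply: val_inj => /=; have [ij|ji|//] := ltngtP i j.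
- by case: (disj i j ij (ltn_ord j) x xi xj).
- by case: (disj j i ji (ltn_ord i) x xj xi).
Qed.

(* A gauge argument: around a good point the increment of [f] is controlled by that
   of [G]; the null set of bad points is covered by an open set of small measure, on
   which the absolute continuity of [f] takes over and [G] needs only be monotone. *)
Lemma abs_continuous_increment_le c d f G : c <= d -> abs_continuous_on c d f ->
  (forall s t, c <= s -> s <= t -> t <= d -> G s <= G t) ->
  {ae leb, forall t, t \in `[c, d] -> [/\ derivable f t 1, derivable G t 1 &
     `|derive1 f t| <= derive1 G t]} ->
  `|f d - f c| <= G d - G c.
Proof.
move=> cd fac Gmono [N [mN N0 goodN]].
(* Good points cost [e' * (d - c)] in total and bad ones [e'], which sums to [eps]. *)
apply/ler_addgt0Pr => eps e0; pose e' := eps / (1 + (d - c)).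
have dc0 : 0 < 1 + (d - c) by rewrite ltr_pwDl // subr_ge0.
have e'0 : 0 < e' by rewrite divr_gt0.
have [delta delta0 small] := abs_continuous_on_seq fac e'0.
have Nfin : (leb N < +oo)%E by rewrite N0.
have [U [oU NU UN]] := lebesgue_regularity_outer mN Nfin delta0.
have mU : measurable U by exact: open_measurable.
have {UN} U_small : (leb U < delta%:E)%E.
  rewrite -(setDUK NU) measureU //=; first by rewrite N0 add0e.
  - exact: measurableD.
  - by rewrite setDE setICA setICr setI0.
have mI u : measurable (U `&` `[c, u]).
  exact: measurableI.
(* The list records the intervals crossed around bad points. Bounding their total length by the
   measure of [U] up to [t] keeps it below [delta] at the end. *)
pose P t := exists l : seq (R * R), [/\
    all (fun q => [&& c <= q.1, q.1 <= q.2 & q.2 <= t]) l,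
    pairwise (fun q' q => q.2 <= q'.1) l,
    ((\sum_(q <- l) (q.2 - q.1))%:E <= leb (U `&` `[c, t]%classic))%E &
    `|f t - f c| <= G t - G c + e' * (t - c) + \sum_(q <- l) `|f q.2 - f q.1| ].
suff [l [l_in l_disj l_meas l_bound]] : P d.
  apply: (le_trans l_bound).
  have /(small _ l_in l_disj) : \sum_(q <- l) (q.2 - q.1) < delta.
    rewrite -lte_fin; apply: (le_lt_trans l_meas); apply: le_lt_trans U_small.
    by apply: le_measure; rewrite ?inE; [exact: mI | exact: mU | exact: subIsetl].
  have : e' * (1 + (d - c)) = eps by rewrite /e' mulfVK // gt_eqF.
  rewrite mulrDr mulr1; lra.
apply: (real_induction cd).
  exists [::]; split => //=; first by rewrite big_nil.
  by rewrite big_nil !subrr normr0 mulr0 !addr0.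
move=> t /andP[ct td].
have [tN|tN] := pselect (N t).
- have [r /= r0 rU] : nbhs_ball t U by apply/nbhs_ballP; apply: open_nbhs_nbhs; split => //; exact: NU.
  exists r => // s v cs st tv vd tsr vtr [l [l_in l_disj l_meas l_bound]].
  exists ((s, v) :: l); split => /=.
  + rewrite cs (le_trans st tv) lexx /=; apply: sub_all l_in => q /and3P[-> -> qs] /=.
    by rewrite (le_trans qs) // (le_trans st).
  + by rewrite l_disj andbT; apply: sub_all l_in => q /and3P[].
  + rewrite big_cons /= EFinD.
    (* The new interval lies in [U] and is disjoint from the part of [U] already counted, so the
       measures add. *)
    apply: (@le_trans _ _ (leb `]s, v] + leb (U `&` `[c, s]))%E).
      apply: leeD => //; rewrite lebesgue_measure_itv /= lte_fin.
      by case: ltP => // vs; rewrite lee_fin; lra.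
    rewrite -measureU; [| exact: measurable_itv | exact: mI |]; last first.
      by apply/seteqP; split => // x [/=]; rewrite !in_itv /= => /andP[sx _] [_ /andP[_ xs]]; lra.
    apply: le_measure; rewrite ?inE.
    * by apply: measurableU; [exact: measurable_itv | exact: mI].
    * exact: mI.
    * move=> x [/=|[Ux] /=]; rewrite !in_itv /= => /andP[h1 h2]; split => //=.
      - apply: rU; rewrite -ball_normE /= ltr_norml; apply/andP; split; lra.
      - by rewrite ?in_itv /=; apply/andP; split; lra.
      - by rewrite ?in_itv /=; apply/andP; split; lra.
  + rewrite big_cons /=.
    have := ler_distD (f s) (f v) (f c).
    have : 0 <= e' * (v - s) by rewrite mulr_ge0 ?(ltW e'0) //; lra.
    have := Gmono s v cs (le_trans st tv) vd.
    lra.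
- have [] : [/\ derivable f t 1, derivable G t 1 & `|derive1 f t| <= derive1 G t].
    apply: contrapT => bad; apply: tN; apply: goodN => /= h; apply: bad; apply: h.
    by rewrite in_itv /= ct.
  move=> df dG fG; have [r r0 Hr] := derive1_le_growth df dG fG e'0.
  exists r => // s v cs st tv vd tsr vtr [l [l_in l_disj l_meas l_bound]].
  exists l; split => //.
  + apply: sub_all l_in => q /and3P[-> -> qs] /=.
    by rewrite (le_trans qs) // (le_trans st).
  + apply: (le_trans l_meas); apply: le_measure; rewrite ?inE; [exact: mI | exact: mI |].
    move=> x [Ux /=]; rewrite !in_itv /= => /andP[-> xs]; split => //=; lra.
  + have := ler_distD (f s) (f v) (f c).
    have := Hr s v st tv tsr vtr; nra.
Qed.

End absolute_continuity.

(** * Integral bounds on increments, and operations preserving absolute continuity *)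

Section absolute_continuity_closure.
Context (R : realType).
Implicit Types (c d : R) (f g G : R -> R).
Local Notation leb := (@lebesgue_measure R).

(** When the integral is finite, the indefinite integral [G] of [g] is nondecreasing and has
    derivative [g] almost everywhere by Lebesgue differentiation, so it can serve as the comparison
    function. *)
Lemma abs_continuous_on_le_integral c d f g : c <= d -> abs_continuous_on c d f ->
  measurable_fun `[c, d] g -> (forall t, t \in `[c, d] -> 0 <= g t) ->
  {ae leb, forall t, t \in `[c, d] -> derivable f t 1 /\ `|derive1 f t| <= g t} ->
  (`|f d - f c|%:E <= \int[leb]_(t in `[c, d]) (g t)%:E)%E.
Proof.
move=> cd fac mg g0 f'g.
have := leey (\int[leb]_(t in `[c, d]) (g t)%:E)%E.
rewrite le_eqVlt => /orP[/eqP ->|g_fin]; first exact: leey.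
have int_g : leb.-integrable `[c, d] (EFin \o g).
  apply/integrableP; split; first exact/measurable_EFinP.
  move: g_fin; congr (_ < _)%E; apply: eq_integral => t /set_mem tcd /=.
  by rewrite ger0_norm // g0.
(* Extension by zero allows a primitive that starts at minus infinity. *)
pose g' := g \_ `[c, d].
have g'0 t : 0 <= g' t by rewrite /g' patchE; case: ifPn => // /set_mem /g0.
have int_g' : leb.-integrable setT (EFin \o g').
  by rewrite /g' -restrict_EFin; apply/integrable_restrict => //; rewrite setTI.
have loc_g' : locally_integrable setT g' by exact: integrable_locally.
have int_g'_le y : leb.-integrable `]-oo, y] (EFin \o g').
  by apply: integrableS int_g' => //.
pose G x := (\int[leb]_(t in `]-oo, x]) g' t)%R.
have EFinG x : ((G x)%:E = \int[leb]_(t in `]-oo, x]) (g' t)%:E)%E.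
  rewrite /G /Rintegral fineK //; exact: integrable_fin_num.
have Gmono s t : s <= t -> G s <= G t.
  move=> st; rewrite -lee_fin !EFinG; apply: ge0_subset_integral => //.
  - exact: measurable_int (int_g'_le t).
  - by move=> x _; rewrite lee_fin.
  - by move=> x /=; rewrite !in_itv /= => /le_trans; apply.
have Gc0 : 0 <= G c by apply: Rintegral_ge0 => x _.
have Gd : ((G d)%:E <= \int[leb]_(t in `[c, d]) (g t)%:E)%E.
  rewrite EFinG integral_mkcond [leRHS]integral_mkcond.
  apply: ge0_le_integral => //.
  - by move=> x _; rewrite patchE; case: ifP => //; rewrite lee_fin.
  - exact: (measurable_restrictT _ (measurable_itv _)).1 (measurable_int leb (int_g'_le d)).
  - exact: (measurable_restrictT _ (measurable_itv _)).1 (measurable_int leb int_g).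
  - move=> x _; rewrite !patchE /g' patchE.
    by case: ifP => // _; case: ifPn => //= /set_mem /g0.
apply: le_trans Gd; rewrite lee_fin.
suff : `|f d - f c| <= G d - G c by lra.
apply: abs_continuous_increment_le => //; first by move=> s t _ st _; exact: Gmono.
have G' := FTC1Ny int_g'_le loc_g'.
move: f'g G'; apply: (@filterS2 _ _ (ae_filter_ringOfSetsType leb)) => t /= H1 [dG G'] tcd.
have [df fg] := H1 tcd; split => //.
by rewrite G' /g' patchE mem_set.
Qed.

Lemma abs_continuous_on_within c d f : abs_continuous_on c d f ->
  {within `[c, d], continuous f}.
Proof.
move=> fac; apply/subspace_continuousP => x /=; rewrite in_itv /= => /andP[cx xd].
apply/cvgrPdist_lt => eps e0; have [delta d0 H] := fac _ e0.
near=> y.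
have /andP[cy yd] : c <= y <= d.
  by have : y \in `[c, d] by near: y; exact: withinT.
have xy : `|x - y| < delta.
  near: y; apply: cvg_within; apply/nbhs_ballP; exists delta => //.
have disj s t : trivIset [set: 'I_1] (fun _ : 'I_1 => `]s, t[%classic : set R).
  by move=> i j _ _ _; rewrite !ord1.
have [xy'|yx] := leP x y.
- have := H 1%N (fun _ => x) (fun _ => y); rewrite !big_ord1 distrC; apply => //.
  by rewrite distrC ger0_norm ?subr_ge0 in xy.
- have := H 1%N (fun _ => y) (fun _ => x); rewrite !big_ord1; apply => //.
    by move=> _; split => //; split => //; exact: ltW.
  by rewrite gtr0_norm ?subr_gt0 in xy.
Unshelve. all: by end_near. Qed.

Lemma abs_continuous_on_measurable c d f : abs_continuous_on c d f ->
  measurable_fun `[c, d] f.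
Proof.
by move=> /abs_continuous_on_within; apply: subspace_continuous_measurable_fun.
Qed.

Lemma abs_continuous_on_sub c d c' d' f : c <= c' -> d' <= d ->
  abs_continuous_on c d f -> abs_continuous_on c' d' f.
Proof.
move=> cc dd fac eps e0; have [delta d0 H] := fac _ e0; exists delta => // n s t st.
apply: H => i; have [? [? ?]] := st i; split; last split => //.
- exact: le_trans cc _.
- exact: le_trans dd.
Qed.

Lemma abs_continuous_on_cst c d (k : R) : abs_continuous_on c d (fun=> k).
Proof.
move=> eps e0; exists 1 => // n s t _ _ _.
by rewrite big1 // => i _; rewrite subrr normr0.
Qed.

Lemma abs_continuous_onD c d f g : abs_continuous_on c d f ->
  abs_continuous_on c d g -> abs_continuous_on c d (fun t => f t + g t).
Proof.
move=> fac gac eps e0; have e20 : 0 < eps / 2 by rewrite divr_gt0.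
have [d1 d10 H1] := fac _ e20; have [d2 d20 H2] := gac _ e20.
exists (Num.min d1 d2); first by rewrite lt_min d10.
move=> n s t st disj; rewrite lt_min => /andP[l1 l2].
rewrite [ltRHS]splitr; apply: le_lt_trans (ltrD (H1 n s t st disj l1) (H2 n s t st disj l2)).
rewrite -big_split /=; apply: ler_sum => i _.
by rewrite opprD addrACA; exact: ler_normD.
Qed.

Lemma abs_continuous_onZ c d (k : R) f : abs_continuous_on c d f ->
  abs_continuous_on c d (fun t => k * f t).
Proof.
move=> fac eps e0; have k0 : 0 < `|k| + 1 by rewrite ltr_wpDl.
have [delta d0 H] := fac (eps / (`|k| + 1)) (divr_gt0 e0 k0).
exists delta => // n s t st disj l; have := H n s t st disj l.
rewrite ltr_pdivlMr //; apply: le_lt_trans.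
rewrite mulr_suml; apply: ler_sum => i _.
by rewrite -mulrBr normrM mulrC ler_wpM2l // lerDl.
Qed.

Lemma abs_continuous_on_sum (I : finType) c d (F : I -> R -> R) :
  (forall i, abs_continuous_on c d (F i)) ->
  abs_continuous_on c d (fun t => \sum_i F i t).
Proof.
move=> Fac; elim: (index_enum I) => [|i l IHl].
  rewrite (_ : (fun _ => _) = fun=> 0); first exact: abs_continuous_on_cst.
  by apply/funext => t; rewrite big_nil.
rewrite (_ : (fun _ => _) = fun t => F i t + \sum_(j <- l) F j t).
  exact: abs_continuous_onD.
by apply/funext => t; rewrite big_cons.
Qed.

(** [phi] need not be injective: gluing uses changes of time that are constant on one of the pieces.
    Strict inequalities between values of a nondecreasing map still pull back, which is enough for
    disjointness. *)
Lemma abs_continuous_on_comp c d c' d' (phi : R -> R) (L : R) f :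
  abs_continuous_on c d f -> 0 < L ->
  {homo phi : s t / s <= t} ->
  (forall s t, s <= t -> phi t - phi s <= L * (t - s)) ->
  c <= phi c' -> phi d' <= d ->
  abs_continuous_on c' d' (f \o phi).
Proof.
move=> fac L0 phi_mono phi_lip cphi phid eps e0.
have [delta d0 H] := fac _ e0; exists (delta / L); first exact: divr_gt0.
move=> n s t st disj; rewrite ltr_pdivlMr // => l.
apply: (H n (phi \o s) (phi \o t)) => /=.
- move=> i; have [? [? ?]] := st i; split; last split; last 1 first.
  + by apply: le_trans phid; exact: phi_mono.
  + by apply: (le_trans cphi); exact: phi_mono.
  + exact: phi_mono.
- move=> i j _ _ [z [/=]]; rewrite !in_itv /= => /andP[iz zi] /andP[jz zj].
  have lt_of u v : phi u < phi v -> u < v.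
    by move=> uv; rewrite ltNge; apply/negP => /phi_mono; rewrite leNgt uv.
  have h1 := lt_of _ _ (lt_trans iz zi); have h2 := lt_of _ _ (lt_trans jz zj).
  have h3 := lt_of _ _ (lt_trans iz zj); have h4 := lt_of _ _ (lt_trans jz zi).
  apply: (disj i j) => //.
  (* If the images overlap, so do the original intervals: this is the midpoint of their
     intersection. *)
  exists ((Num.max (s i) (s j) + Num.min (t i) (t j)) / 2); split => /=; rewrite in_itv /=;
    case: (leP (s i) (s j)) => ?; case: (leP (t i) (t j)) => ?; lra.
- apply: le_lt_trans l; rewrite mulr_suml; apply: ler_sum => i _.
  by rewrite mulrC; apply: phi_lip; have [_ []] := st i.
Qed.

(** Reflection is decreasing, so the previous lemma does not cover it. *)
Lemma abs_continuous_on_opp c d f : abs_continuous_on c d f ->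
  abs_continuous_on (- d) (- c) (fun t => f (- t)).
Proof.
move=> fac eps e0; have [delta d0 H] := fac _ e0; exists delta => // n s t st disj l.
under eq_bigr do rewrite distrC.
apply: (H n (fun i => - t i) (fun i => - s i)).
- by move=> i; have [? [? ?]] := st i; split; [lra | split; lra].
- move=> i j _ _ [z [/=]]; rewrite !in_itv /= => iz jz.
  apply: (disj i j) => //; exists (- z); split; rewrite /= in_itv /=; lra.
- by under eq_bigr do rewrite opprK addrC.
Qed.

End absolute_continuity_closure.

(** * The logarithmic mean: closed form, bounds, measurability, continuity *)

Section logarithmic_mean.
Context (R : realType).
Implicit Types u v : R.
Local Notation leb := (@lebesgue_measure R).

Lemma log_mean0 u v : u = 0 \/ v = 0 -> log_mean u v = 0.
Proof.
move=> uv0; rewrite /log_mean /Rintegral.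
rewrite (@eq_integral_itv_bounded _ 0 1 (fun=> 0)) ?integral0 //.
- apply: measurable_funM; first exact: measurable_funTS (measurable_powRr u).
  apply: (@measurableT_comp _ _ _ _ _ _ (powR v)); first exact: measurable_powRr.
  exact: measurable_funB.
- move=> x; rewrite in_itv /= => /andP[x0 x1].
  by case: uv0 => ->; rewrite powR0 ?mul0r ?mulr0 // gt_eqF // subr_gt0.
Qed.

Lemma log_mean0l v : log_mean 0 v = 0.
Proof. by rewrite log_mean0 //; left. Qed.

Lemma log_mean0r u : log_mean u 0 = 0.
Proof. by rewrite log_mean0 //; right. Qed.

Lemma log_mean_diag u : 0 < u -> log_mean u u = u.
Proof.
move=> u0; rewrite /log_mean.
rewrite (@eq_Rintegral _ _ _ _ _ (fun=> u)); last first.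
  move=> x _; rewrite -powRD; last by rewrite addrC subrK oner_eq0.
  by rewrite addrC subrK powRr1 // ltW.
by rewrite Rintegral_cst //= lebesgue_measure_itv /= lte_fin ltr01 oppr0 adde0 mulr1.
Qed.

(** With s = ln u - ln v the integrand is v exp(s xi), whose primitive is v exp(s xi) / s. *)
Lemma log_mean_formula u v : 0 < u -> 0 < v -> u != v ->
  log_mean u v = (u - v) / (ln u - ln v).
Proof.
move=> u0 v0 uv; set s := ln u - ln v.
have s0 : s != 0.
  apply: contra uv; rewrite subr_eq0 => /eqP /ln_inj; rewrite !posrE => -> //.
have -> : (u - v) / s = v * expR (s * 1) / s - v * expR (s * 0) / s.
  rewrite mulr1 mulr0 expR0 mulr1 -mulrBl /s expRD expRN !lnK ?posrE //.
  by rewrite mulrCA divff ?gt_eqF // mulr1.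
transitivity (\int[leb]_(x in `[0, 1]) (v * expR (s * x)))%R.
  apply: eq_Rintegral => x _; rewrite /powR !gt_eqF // -expRD -[in RHS](@lnK _ v) ?posrE // -expRD.
  by congr expR; rewrite /s; ring.
have dF (x : R) : is_derive x 1 (fun x => v * expR (s * x) / s) (v * expR (s * x)).
  have -> : (fun x => v * expR (s * x) / s) = (v / s) *: (expR \o ( *%R s)).
    by apply/funext => y /=; rewrite /GRing.scale /= mulrAC.
  apply: is_derive_eq.
  by rewrite /GRing.scale /= mulr1; field.
have cF (k : R) : continuous (fun x => v * expR (s * x) * k).
  move=> y; apply: cvgMl; apply: cvgMr.
  apply: continuous_comp; last exact: continuous_expR.
  by apply: cvgMr; exact: cvg_id.
have FTC := @continuous_FTC2 R (fun x => v * expR (s * x)) (fun x => v * expR (s * x) / s) 0 1.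
transitivity (fine ((v * expR (s * 1) / s)%:E - (v * expR (s * 0) / s)%:E)%E); last by [].
congr fine; apply: FTC => //.
- apply: continuous_subspaceT => x.
  by have := cF 1 x; rewrite (_ : (fun _ => _) = fun x => v * expR (s * x)) //;
    apply/funext => y; rewrite mulr1.
- split.
  + by move=> x _; exact: ex_derive.
  + by apply: cvg_at_right_filter; exact: cF.
  + by apply: cvg_at_left_filter; exact: cF.
- by move=> x _; rewrite derive1E; exact: derive_val.
Qed.

Lemma log_meanC u v : 0 <= u -> 0 <= v -> log_mean u v = log_mean v u.
Proof.
rewrite 2!le_eqVlt => /predU1P[<- _|u0]; first by rewrite log_mean0l log_mean0r.
move=> /predU1P[<-|v0]; first by rewrite log_mean0l log_mean0r.
have [->//|uv] := eqVneq u v.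
rewrite !log_mean_formula //; last by rewrite eq_sym.
by rewrite -[u - v]opprB -[ln u - ln v]opprB invrN mulrNN.
Qed.

(* Both bounds come from [ln x <= x - 1]. *)
Lemma log_mean_between u v : 0 < v -> v <= u -> v <= log_mean u v <= u.
Proof.
move=> v0; rewrite le_eqVlt => /predU1P[<-|vu]; first by rewrite log_mean_diag ?lexx.
have u0 := lt_trans v0 vu.
rewrite log_mean_formula ?gt_eqF // -ln_div ?posrE //.
have luv : 0 < ln (u / v) by rewrite ln_gt0 // ltr_pdivlMr // mul1r.
have h (x : R) : 0 < x -> ln x <= x - 1.
  by move=> x0; have := @le_ln1Dx R (x - 1); rewrite [1 + _]addrC subrK; apply; lra.
apply/andP; split.
- rewrite ler_pdivlMr //; apply: le_trans (ler_wpM2l (ltW v0) (h _ (divr_gt0 u0 v0))) _.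
  by rewrite mulrBr mulr1 mulrCA divff ?mulr1 // gt_eqF.
- rewrite ler_pdivrMr // -[ln _]opprK -lnV ?posrE ?divr_gt0 // invf_div mulrN lerNr.
  apply: le_trans (ler_wpM2l (ltW u0) (h _ (divr_gt0 v0 u0))) _.
  by rewrite mulrBr mulr1 mulrCA divff ?mulr1 ?gt_eqF // opprB.
Qed.

Lemma log_mean_bounds u v : 0 < u -> 0 < v ->
  Num.min u v <= log_mean u v <= Num.max u v.
Proof.
move=> u0 v0; have [uv|vu] := leP u v.
  by rewrite (log_meanC (ltW u0) (ltW v0)); exact: log_mean_between.
by apply: log_mean_between => //; exact: ltW.
Qed.

Lemma log_mean_ge0 u v : 0 <= u -> 0 <= v -> 0 <= log_mean u v.
Proof.
rewrite 2!le_eqVlt => /predU1P[<-|u0] /predU1P[<-|v0]; rewrite ?log_mean0l ?log_mean0r ?lexx //.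
by apply: le_trans (andP (log_mean_bounds u0 v0)).1; rewrite le_min !ltW.
Qed.

Lemma log_mean_gt0 u v : 0 < u -> 0 < v -> 0 < log_mean u v.
Proof.
by move=> u0 v0; apply: lt_le_trans (andP (log_mean_bounds u0 v0)).1; rewrite lt_min u0.
Qed.

Lemma log_mean_le u v M : 0 <= u <= M -> 0 <= v <= M -> log_mean u v <= M.
Proof.
move=> /andP[u0 uM] /andP[v0 vM]; have M0 := le_trans u0 uM.
move: u0 v0; rewrite 2!le_eqVlt => /predU1P[<-|u0] /predU1P[<-|v0];
  rewrite ?log_mean0l ?log_mean0r //.
by apply: le_trans (andP (log_mean_bounds u0 v0)).2 _; rewrite ge_max uM.
Qed.

Lemma measurable_log_mean d (T : measurableType d) (D : set T) (f g : T -> R) :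
  measurable D -> measurable_fun D f -> measurable_fun D g ->
  (forall t, D t -> 0 <= f t) -> (forall t, D t -> 0 <= g t) ->
  measurable_fun D (fun t => log_mean (f t) (g t)).
Proof.
move=> mD mf mg f0 g0.
(* Measurability is read off the piecewise closed form. The inverse is written as a real power,
   hence the absolute values; they change nothing because the quotient is positive. *)
apply: (@eq_measurable_fun _ _ _ _ D (fun t => if (f t <= 0) || (g t <= 0) then 0 else
   if f t == g t then f t else `|f t - g t| * `|ln (f t) - ln (g t)| `^ (-1))).
  move=> t /set_mem Dt.
  have [ft|ft] := leP (f t) 0 => /=.
    by rewrite log_mean0 //; left; apply/eqP; rewrite eq_le ft f0.
  have [gt|gt] := leP (g t) 0 => /=.
    by rewrite log_mean0 //; right; apply/eqP; rewrite eq_le gt g0.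
  have [fg|fg] := eqVneq (f t) (g t); first by rewrite -fg log_mean_diag.
  rewrite powR_inv1 // -normfV -normrM -log_mean_formula //.
  by rewrite ger0_norm // ltW // log_mean_gt0.
apply: measurable_fun_if => //.
  by apply: measurable_or; apply: measurable_fun_ler => //; exact: measurable_cst.
apply: (@measurable_funS _ _ _ _ D) => //.
apply: measurable_fun_if => //; first exact: measurable_fun_eqr.
  by apply: (@measurable_funS _ _ _ _ D).
apply: (@measurable_funS _ _ _ _ D) => //.
apply: measurable_funM.
  by apply: measurableT_comp => //; exact: measurable_funB.
apply: (@measurableT_comp _ _ _ _ _ _ (fun x => x `^ (-1))); first exact: measurable_powR.
apply: measurableT_comp => //; apply: measurable_funB;
  by apply: measurableT_comp => //; exact: measurable_ln.
Qed.

(** Where the arguments agree, the mean is squeezed between their minimum and maximum; elsewhere the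
    closed form holds in a neighbourhood. *)
Lemma log_mean_continuous (f g : R -> R) (t : R) :
  {for t, continuous f} -> {for t, continuous g} -> 0 < f t -> 0 < g t ->
  {for t, continuous (fun s => log_mean (f s) (g s))}.
Proof.
move=> cf cg f0 g0.
have nf : \forall s \near t, 0 < f s by exact: cvgr_gt cf _ f0.
have ng : \forall s \near t, 0 < g s by exact: cvgr_gt cg _ g0.
have [fg|fg] := eqVneq (f t) (g t).
  rewrite /prop_for /continuous_at -fg log_mean_diag //.
  apply: (@squeeze_cvgr _ _ _ _ (fun s => Num.min (f s) (g s)) (fun s => Num.max (f s) (g s))).
  - by near=> s; apply: log_mean_bounds; near: s.
  - have -> : f t = Num.min (f t) (g t) by rewrite -fg minxx.
    exact: continuous_min.
  - have -> : f t = Num.max (f t) (g t) by rewrite -fg maxxx.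
    exact: continuous_max.
rewrite /prop_for /continuous_at log_mean_formula //.
have nfg : \forall s \near t, f s - g s != 0.
  have h : f s - g s @[s --> t] --> f t - g t by exact: cvgB cf cg.
  by apply: (cvgr_neq0 _ h); rewrite subr_eq0.
have E : {near t, (fun s => (f s - g s) / (ln (f s) - ln (g s))) =1
                  (fun s => log_mean (f s) (g s))}.
  move: nf ng nfg; apply: filterS3 => s fs gs fgs.
  by rewrite log_mean_formula // -subr_eq0.
apply: cvg_trans (near_eq_cvg E) _.
apply: cvgM; first exact: cvgB.
apply: cvgV; last apply: cvgB.
- rewrite subr_eq0; apply: contra fg => /eqP /ln_inj; rewrite !posrE => -> //.
- by apply: continuous_comp cf _; exact: continuous_ln.
- by apply: continuous_comp cg _; exact: continuous_ln.
Unshelve. all: by end_near. Qed.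

End logarithmic_mean.

(** * The instantaneous cost and the pointwise continuity equation *)

Section paths.
Context (R : realType) (X : finType) (K : X -> X -> R) (w p : X -> R) (a b : R).
Hypothesis K_ge0 : forall x y, 0 <= K x y.
Hypothesis w_ge0 : forall x, 0 <= w x.
Local Notation leb := (@lebesgue_measure R).
Implicit Types (m f : X -> R) (mu psi : R -> X -> R) (h : R -> R) (t k : R).

(** The integrand of the action as a single function, so that a change of time acts on it by one
    scaling. *)
Definition cost m f (r : R) : R :=
  a ^+ 2 * r ^+ 2 + b ^+ 2 * (2^-1 * \sum_(x : X) \sum_(y : X)
    (f y - f x) ^+ 2 * hat m x y * K x y * w x).

(** Spelled as in [CE_equation], so that the two are convertible. *)
Definition flow_at mu psi h t : Prop :=
  forall x, derivable (fun s => mu s x) t 1 /\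
    derive1 (fun s => mu s x) t
      + \sum_(y : X) (psi t y - psi t x) * hat (mu t) x y * K x y = h t * p x.

Lemma hat_ge0 m x y : nonneg_densities m -> 0 <= hat m x y.
Proof. by move=> m0; apply: log_mean_ge0; exact: m0. Qed.

Lemma energy_ge0 m f : nonneg_densities m ->
  0 <= 2^-1 * \sum_(x : X) \sum_(y : X) (f y - f x) ^+ 2 * hat m x y * K x y * w x.
Proof.
move=> m0; rewrite mulr_ge0 // sumr_ge0 // => x _; rewrite sumr_ge0 // => y _.
by rewrite mulr_ge0 // mulr_ge0 // mulr_ge0 ?sqr_ge0 // hat_ge0.
Qed.

Lemma cost_ge0 m f r : nonneg_densities m -> 0 <= cost m f r.
Proof.
by move=> m0; rewrite addr_ge0 // mulr_ge0 ?sqr_ge0 // energy_ge0.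
Qed.

Lemma cost_scale m f r k : cost m (fun x => k * f x) (k * r) = k ^+ 2 * cost m f r.
Proof.
rewrite /cost mulrDr exprMn mulrCA; congr (_ + _).
rewrite [RHS]mulrCA [k ^+ 2 * _]mulrCA; congr (_ * (_ * _)).
rewrite mulr_sumr; apply: eq_bigr => x _; rewrite mulr_sumr; apply: eq_bigr => y _.
by rewrite -mulrBr exprMn !mulrA.
Qed.

Lemma CE_measurable_energy m0 m1 mu psi h : CE K p m0 m1 mu psi h ->
  measurable_fun (`[0, 1] : set R) (fun t => 2^-1 * \sum_(x : X) \sum_(y : X)
    (psi t y - psi t x) ^+ 2 * hat (mu t) x y * K x y * w x).
Proof.
move=> ce; apply: measurable_funM => //; apply: measurable_sum => x.
apply: measurable_sum => y; do 2 (apply: measurable_funM => //).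
apply: measurable_funM.
  by apply: measurable_funX; apply: measurable_funB; exact: CE_measurable_psi ce _.
apply: measurable_log_mean => //.
- exact: abs_continuous_on_measurable (CE_abs_continuous ce x).
- exact: abs_continuous_on_measurable (CE_abs_continuous ce y).
- by move=> t tI; exact: (CE_nonneg ce).
- by move=> t tI; exact: (CE_nonneg ce).
Qed.

Lemma CE_measurable_cost m0 m1 mu psi h : CE K p m0 m1 mu psi h ->
  measurable_fun (`[0, 1] : set R) (fun t => cost (mu t) (psi t) (h t)).
Proof.
move=> ce; apply: measurable_funD; apply: measurable_funM => //.
  by apply: measurable_funX; exact: CE_measurable_h ce.
exact: CE_measurable_energy ce.
Qed.

Lemma action_cost m0 m1 mu psi h : CE K p m0 m1 mu psi h ->
  action K w a b mu psi h =
    (\int[leb]_(t in `[0%R, 1%R]) (cost (mu t) (psi t) (h t))%:E)%E.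
Proof.
move=> ce; rewrite /action.
have mE := CE_measurable_energy ce.
have mh : measurable_fun (`[0, 1] : set R) (fun t => h t ^+ 2).
  by apply: measurable_funX; exact: CE_measurable_h ce.
have E0 t : t \in `[0, 1] -> 0 <= 2^-1 * \sum_(x : X) \sum_(y : X)
    (psi t y - psi t x) ^+ 2 * hat (mu t) x y * K x y * w x.
  by move=> tI; apply: energy_ge0; exact: (CE_nonneg ce).
rewrite -ge0_integralZl_EFin ?sqr_ge0 //; last 2 first.
- by move=> t _; rewrite lee_fin sqr_ge0.
- exact/measurable_EFinP.
rewrite -ge0_integralZl_EFin ?sqr_ge0 //; last exact/measurable_EFinP.
rewrite -ge0_integralD //.
- by move=> t _; rewrite -EFinM lee_fin mulr_ge0 // sqr_ge0.
- by apply/measurable_EFinP; apply: measurable_funM.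
- by move=> t tI; rewrite -EFinM lee_fin mulr_ge0 ?sqr_ge0 // E0.
- by apply/measurable_EFinP; apply: measurable_funM.
Qed.

Lemma derive1_affine_comp (f : R -> R) k c t : derivable f (k * t + c) 1 ->
  derivable (fun s => f (k * s + c)) t 1 /\
  derive1 (fun s => f (k * s + c)) t = k * derive1 f (k * t + c).
Proof.
move=> df.
have dl : is_derive t 1 (fun s => k * s + c) k.
  have -> : (fun s => k * s + c) = (k *: id) + cst c by [].
  by apply: is_derive_eq; rewrite addr0 /GRing.scale /= mulr1.
have df' : is_derive (k * t + c) 1 f (derive1 f (k * t + c)).
  by rewrite derive1E; split.
have := is_derive1_comp (f := f) (g := fun s => k * s + c) df' dl.
move=> [d1 d2]; split => //; rewrite derive1E d2.
by rewrite mulrC.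
Qed.

Lemma flow_at_affine mu psi h k c t : flow_at mu psi h (k * t + c) ->
  flow_at (fun s => mu (k * s + c)) (fun s x => k * psi (k * s + c) x)
    (fun s => k * h (k * s + c)) t.
Proof.
move=> eq_t x; have [dmu muE] := eq_t x; have [d1 d2] := derive1_affine_comp dmu.
split => //; rewrite d2 -mulrA -muE mulrDr; congr (_ + _).
by rewrite mulr_sumr; apply: eq_bigr => y _; rewrite -mulrBr !mulrA.
Qed.

(** The derivative makes the equation depend on the density near [t], but on the potential and the
    source only at [t]. *)
Lemma flow_at_near mu psi h mu' psi' h' t : flow_at mu psi h t ->
  (\forall s \near t, mu s = mu' s) -> psi t = psi' t -> h t = h' t ->
  flow_at mu' psi' h' t.
Proof.
move=> eq_t mumu' psiE hE x; have [dmu muE] := eq_t x.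
have nearx : \forall s \near t, mu s x = mu' s x.
  by apply: filterS mumu' => s ->.
split; first exact: near_eq_derivable nearx dmu.
rewrite -hE -psiE -muE !derive1E -(near_eq_derive _ nearx).
by have -> : mu' t = mu t by rewrite (nbhs_singleton mumu').
Qed.

End paths.

(** * Reversal and concatenation of paths *)

Section triangle.
Context (R : realType) (X : finType) (K : X -> X -> R) (w p : X -> R) (a b : R).
Hypothesis K_ge0 : forall x y, 0 <= K x y.
Hypothesis w_ge0 : forall x, 0 <= w x.
Local Notation leb := (@lebesgue_measure R).
Implicit Types (m f : X -> R) (mu psi : R -> X -> R) (h : R -> R) (t k : R).

Lemma measurable_fun_affine_comp k c (D E : set R) (f : R -> R) : measurable D ->
  measurable E -> (forall t, D t -> E (k * t + c)) -> measurable_fun E f ->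
  measurable_fun D (fun t => f (k * t + c)).
Proof.
move=> mD mE DE mf; apply: (measurable_comp mE _ mf).
  by move=> _ [t Dt <-]; exact: DE.
by apply: (@measurable_funS _ _ _ _ setT) => //; exact: measurable_affine.
Qed.

Lemma measurable_cost_affine m0 m1 mu psi h k c (D : set R) :
  CE K p m0 m1 mu psi h -> measurable D ->
  (forall t, D t -> k * t + c \in `[0, 1]) ->
  measurable_fun D (fun t => (cost K w a b (mu (k * t + c)) (psi (k * t + c))
    (h (k * t + c)))%:E).
Proof.
move=> ce mD D01; apply/measurable_EFinP.
apply: (@measurable_fun_affine_comp _ _ _ `[0, 1]
  (fun t => cost K w a b (mu t) (psi t) (h t))) => //.
exact: CE_measurable_cost ce.
Qed.

(** Running a path at speed [k] multiplies potential and source by [k], hence the cost by k^2; the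
    change of variable gives back 1 / |k|. *)
Lemma integral_cost_affine m0 m1 mu psi h k c (D : set R) :
  CE K p m0 m1 mu psi h -> k != 0 -> measurable D ->
  affine k c @^-1` `[0, 1] = D ->
  (\int[leb]_(t in D) (cost K w a b (mu (k * t + c))
     (fun x => k * psi (k * t + c) x) (k * h (k * t + c)))%:E =
   `|k|%:E * action K w a b mu psi h)%E.
Proof.
move=> ce k0 mD DE.
have mc : measurable_fun (`[0, 1] : set R) (fun t => cost K w a b (mu t) (psi t) (h t)).
  exact: CE_measurable_cost ce.
have c0 t : t \in `[0, 1] -> 0 <= cost K w a b (mu t) (psi t) (h t).
  by move=> tI; apply: cost_ge0 => //; exact: (CE_nonneg ce).
have D01 t : D t -> k * t + c \in `[0, 1] by rewrite -DE.
have mcD := measurable_cost_affine ce mD D01.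
rewrite (action_cost a b K_ge0 w_ge0 ce) (ge0_integral_affine c k0 (measurable_itv _)); last 2 first.
- exact/measurable_EFinP.
- by move=> t tI; rewrite lee_fin c0.
rewrite DE muleA -EFinM -normrM -expr2 ger0_norm ?sqr_ge0 //.
rewrite -ge0_integralZl_EFin ?sqr_ge0 //; last by move=> t Dt; rewrite lee_fin c0 // D01.
by apply: eq_integral => t _; rewrite cost_scale EFinM.
Qed.

Lemma CE_reverse m0 m1 mu psi h : CE K p m0 m1 mu psi h ->
  CE K p m1 m0 (fun t => mu (-1 * t + 1)) (fun t x => -1 * psi (-1 * t + 1) x)
    (fun t => -1 * h (-1 * t + 1)).
Proof.
move=> ce.
have rev01 t : t \in `[0, 1] -> -1 * t + 1 \in `[0, 1].
  by rewrite !in_itv /= => /andP[? ?]; apply/andP; split; lra.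
split.
- by move=> t /rev01; exact: (CE_nonneg ce).
- move=> x; have := abs_continuous_on_opp (CE_abs_continuous ce x).
  rewrite oppr0 => fac.
  (* The reflection 1 - t is a negation after the translation t - 1, which is nondecreasing. *)
  have -> : (fun t => mu (-1 * t + 1) x) = (fun t => mu (- t) x) \o (fun t => t - 1).
    by apply/funext => t /=; congr (mu _ x); ring.
  apply: (abs_continuous_on_comp fac (L := 1)) => //.
  + by move=> s t; rewrite lerD2r.
  + by move=> s t _ /=; lra.
  + by rewrite sub0r.
- move=> x; apply: measurable_funM => //.
  apply: (@measurable_fun_affine_comp _ _ _ `[0, 1] (fun t => psi t x)) => //.
  exact: CE_measurable_psi ce x.
- apply: measurable_funM => //.
  by apply: (@measurable_fun_affine_comp _ _ _ `[0, 1] h) => //; exact: CE_measurable_h ce.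
- have /(ae_affine 1 (k := -1)) : (-1 : R) != 0 by rewrite oppr_eq0 oner_eq0.
  move=> /(_ _ (CE_equation ce)); apply: (@filterS _ _ (ae_filter_ringOfSetsType leb)).
  move=> t eq_t /rev01 /eq_t; exact: flow_at_affine.
- by rewrite mulr0 add0r; exact: CE_end ce.
- by rewrite mulr1 addNr; exact: CE_start ce.
Qed.

Lemma action_reverse m0 m1 mu psi h : CE K p m0 m1 mu psi h ->
  action K w a b (fun t => mu (-1 * t + 1)) (fun t x => -1 * psi (-1 * t + 1) x)
    (fun t => -1 * h (-1 * t + 1)) = action K w a b mu psi h.
Proof.
move=> ce; rewrite (action_cost a b K_ge0 w_ge0 (CE_reverse ce)).
rewrite (integral_cost_affine ce) ?oppr_eq0 ?oner_eq0 ?normrN1 ?mul1e //.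
by apply/seteqP; split => t /=; rewrite /affine !in_itv /= => /andP[? ?]; apply/andP; split; lra.
Qed.

Lemma W_symmetric_le m0 m1 : (W K w a b p m0 m1 <= W K w a b p m1 m0)%E.
Proof.
rewrite /W lee_sqrt; last first.
  apply/ereal_infP => _ [mu [psi [h [ce ->]]]].
  rewrite (action_cost a b K_ge0 w_ge0 ce).
  by apply: integral_ge0 => t tI; rewrite lee_fin cost_ge0 //; exact: (CE_nonneg ce).
apply/ereal_infP => _ [mu [psi [h [ce ->]]]].
apply: ereal_inf_lbound; exists (fun t => mu (-1 * t + 1)),
  (fun t x => -1 * psi (-1 * t + 1) x), (fun t => -1 * h (-1 * t + 1)).
by split; [exact: CE_reverse ce | rewrite (action_reverse ce)].
Qed.

Section glue.
Variable lam : R.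
Hypothesis lam01 : 0 < lam < 1.

(** Both branches have the shape [k * t + c] of the affine lemmas, whence the [+ 0]. The second time
    change sends [lam] to 0 and 1 to 1. *)
Definition glue (T : Type) (u v : R -> T) (t : R) : T :=
  if t <= lam then u (lam^-1 * t + 0) else v ((1 - lam)^-1 * t + (1 - (1 - lam)^-1)).

Let lam0 : 0 < lam. Proof. by case/andP: lam01. Qed.
Let lam1 : 0 < 1 - lam. Proof. by rewrite subr_gt0; case/andP: lam01. Qed.

Lemma glue_left01 t : (lam^-1 * t + 0 \in `[0, 1]) = (0 <= t <= lam).
Proof. by rewrite in_itv /= addr0 mulrC ler_pdivrMr // ler_pdivlMr // mul0r mul1r. Qed.

Lemma glue_rightE t : (1 - lam)^-1 * t + (1 - (1 - lam)^-1) = (t - lam) / (1 - lam).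
Proof. by field; rewrite gt_eqF. Qed.

Lemma glue_right01 t :
  ((1 - lam)^-1 * t + (1 - (1 - lam)^-1) \in `[0, 1]) = (lam <= t <= 1).
Proof.
by rewrite glue_rightE in_itv /= ler_pdivrMr // ler_pdivlMr // mul0r mul1r subr_ge0 lerD2r.
Qed.

Lemma measurable_glue (u v : R -> R) : measurable_fun (`[0, 1] : set R) u ->
  measurable_fun (`[0, 1] : set R) v -> measurable_fun (`[0, 1] : set R) (glue u v).
Proof.
move=> mu mv; apply: measurable_fun_if => //.
- by apply: measurable_fun_ler => //; exact: measurable_cst.
- apply: (@measurable_funS _ _ _ _ `[0, lam]) => //.
    by move=> t /= []; rewrite !in_itv /= => /andP[-> _].
  apply: (measurable_fun_affine_comp _ _ _ mu) => // t /=.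
  by rewrite in_itv /= -glue_left01.
- apply: (@measurable_funS _ _ _ _ `[lam, 1]) => //.
    by move=> t /= []; rewrite !in_itv /= => /andP[_ ->] /negbT; rewrite -ltNge => /ltW ->.
  apply: (measurable_fun_affine_comp _ _ _ mv) => // t /=.
  by rewrite in_itv /= -glue_right01.
Qed.

(** Clamping the time at [lam] writes the glued function as a sum of two compositions: on each side
    of [lam] one of them is constant, and the matching value [u 1 = v 0] is subtracted once. *)
Lemma abs_continuous_on_glue (u v : R -> R) : abs_continuous_on 0 1 u ->
  abs_continuous_on 0 1 v -> u 1 = v 0 -> abs_continuous_on 0 1 (glue u v).
Proof.
move=> uac vac uv.
pose phi t := Num.min t lam / lam.
pose chi t := (Num.max t lam - lam) / (1 - lam).
have -> : glue u v = fun t => (u \o phi) t + ((v \o chi) t + - v 0).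
  apply/funext => t; rewrite /glue /= /phi /chi; have [tl|tl] := leP t lam.
    by rewrite addr0 mulrC subrr mul0r subrr addr0.
  by rewrite divff ?gt_eqF // glue_rightE uv; ring.
apply: abs_continuous_onD; last apply: abs_continuous_onD.
- apply: (abs_continuous_on_comp uac (L := lam^-1)); rewrite ?invr_gt0 //.
  + by move=> s t st; rewrite ler_pM2r ?invr_gt0 // le_min2 ?lexx.
  + move=> s t st; rewrite -mulrBl mulrC ler_pM2l ?invr_gt0 //.
    by case: (leP t lam) => ?; case: (leP s lam) => ?; lra.
  + by rewrite /phi min_l ?mul0r // ltW.
  + by rewrite /phi min_r ?divff ?gt_eqF // ltW; case/andP: lam01.
- apply: (abs_continuous_on_comp vac (L := (1 - lam)^-1)); rewrite ?invr_gt0 //.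
  + by move=> s t st; rewrite ler_pM2r ?invr_gt0 // lerD2r le_max2 ?lexx.
  + move=> s t st; rewrite -mulrBl mulrC ler_pM2l ?invr_gt0 //.
    by case: (leP t lam) => ?; case: (leP s lam) => ?; lra.
  + by rewrite /chi max_r ?subrr ?mul0r // ltW.
  + by rewrite /chi max_l ?divff ?gt_eqF // ltW; case/andP: lam01.
- exact: abs_continuous_on_cst.
Qed.

Section glue_paths.
Variables (m0 m1 m2 : X -> R) (mu1 mu2 psi1 psi2 : R -> X -> R) (h1 h2 : R -> R).
Hypothesis ce1 : CE K p m0 m1 mu1 psi1 h1.
Hypothesis ce2 : CE K p m1 m2 mu2 psi2 h2.

Let mu := glue mu1 mu2.
Let psi := glue (fun t x => lam^-1 * psi1 t x) (fun t x => (1 - lam)^-1 * psi2 t x).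
Let h := glue (fun t => lam^-1 * h1 t) (fun t => (1 - lam)^-1 * h2 t).

Lemma CE_glue : CE K p m0 m2 mu psi h.
Proof.
split.
- move=> t; rewrite in_itv /= => /andP[t0 t1]; rewrite /mu /glue; case: ifPn.
    by move=> tl; apply: (CE_nonneg ce1); rewrite glue_left01 t0.
  by rewrite -ltNge => lt; apply: (CE_nonneg ce2); rewrite glue_right01 t1 ltW.
- move=> x; rewrite (_ : (fun t => _) = glue (fun t => mu1 t x) (fun t => mu2 t x)).
    apply: abs_continuous_on_glue; [exact: CE_abs_continuous ce1 x | exact: CE_abs_continuous ce2 x |].
    by rewrite (CE_end ce1) (CE_start ce2).
  by apply/funext => t; rewrite /mu /glue; case: ifP.
- move=> x; rewrite (_ : (fun t => _) =
      glue (fun t => lam^-1 * psi1 t x) (fun t => (1 - lam)^-1 * psi2 t x)).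
    by apply: measurable_glue; apply: measurable_funM => //;
      [exact: CE_measurable_psi ce1 x | exact: CE_measurable_psi ce2 x].
  by apply/funext => t; rewrite /psi /glue; case: ifP.
- by apply: measurable_glue; apply: measurable_funM => //;
    [exact: CE_measurable_h ce1 | exact: CE_measurable_h ce2].
- have ae1 := ae_affine 0 (invr_neq0 (lt0r_neq0 lam0)) (CE_equation ce1).
  have ae2 := ae_affine (1 - (1 - lam)^-1) (invr_neq0 (lt0r_neq0 lam1)) (CE_equation ce2).
  (* At the junction the two one-sided derivatives may differ, but a single time is negligible. *)
  have ae_lam : {ae leb, forall t, t != lam}.
    exists [set lam]; split; [exact: measurable_set1 | exact: lebesgue_measure_set1 |].
    by move=> t /= /negP; rewrite negbK => /eqP.
  move: ae1 ae2 ae_lam; apply: (@filterS3 _ _ (ae_filter_ringOfSetsType leb)).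
  move=> t eq1 eq2 tlam; rewrite in_itv /= => /andP[t0 t1].
  have [tl|lt|tl] := ltgtP t lam; last by rewrite tl eqxx in tlam.
  + apply: (@flow_at_near _ _ _ _ (fun s => mu1 (lam^-1 * s + 0))
      (fun s x => lam^-1 * psi1 (lam^-1 * s + 0) x) (fun s => lam^-1 * h1 (lam^-1 * s + 0))).
    * by apply: flow_at_affine; apply: eq1; rewrite glue_left01 t0 ltW.
    * near=> s; rewrite /mu /glue ifT //; apply: ltW; near: s; exact: lt_nbhsl.
    * by rewrite /psi /glue ltW.
    * by rewrite /h /glue ltW.
  + apply: (@flow_at_near _ _ _ _ (fun s => mu2 ((1 - lam)^-1 * s + (1 - (1 - lam)^-1)))
      (fun s x => (1 - lam)^-1 * psi2 ((1 - lam)^-1 * s + (1 - (1 - lam)^-1)) x)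
      (fun s => (1 - lam)^-1 * h2 ((1 - lam)^-1 * s + (1 - (1 - lam)^-1)))).
    * by apply: flow_at_affine; apply: eq2; rewrite glue_right01 t1 ltW.
    * near=> s; rewrite /mu /glue ifF //; apply/negbTE; rewrite -ltNge.
      near: s; exact: lt_nbhsr.
    * by rewrite /psi /glue leNgt lt.
    * by rewrite /h /glue leNgt lt.
- by rewrite /mu /glue ltW // mulr0 addr0; exact: CE_start ce1.
- rewrite /mu /glue leNgt (_ : lam < 1) ?(andP lam01).2 //= mulr1 addrCA subrr addr0.
  exact: CE_end ce2.
Unshelve. all: by end_near. Qed.

Lemma action_glue : (action K w a b mu psi h <=
  (lam^-1)%:E * action K w a b mu1 psi1 h1 + ((1 - lam)^-1)%:E * action K w a b mu2 psi2 h2)%E.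
Proof.
rewrite (action_cost a b K_ge0 w_ge0 CE_glue).
have mc : measurable_fun (`[0, 1] : set R) (fun t => cost K w a b (mu t) (psi t) (h t)).
  exact: CE_measurable_cost CE_glue.
have c0 t : t \in `[0, 1] -> (0 <= (cost K w a b (mu t) (psi t) (h t))%:E)%E.
  by move=> tI; rewrite lee_fin cost_ge0 //; exact: (CE_nonneg CE_glue).
have split01 : `[0, 1]%classic = `[0, lam]%classic `|` `]lam, 1]%classic :> set R.
  by apply: itv_bndbnd_setU; rewrite bnd_simp ltW //; case/andP: lam01.
have mc' : measurable_fun (`[0, lam]%classic `|` `]lam, 1]%classic : set R)
    (fun t => (cost K w a b (mu t) (psi t) (h t))%:E).
  by rewrite -split01; exact/measurable_EFinP.
rewrite {1}split01 (ge0_integral_setU leb (measurable_itv _) (measurable_itv _) mc'); last 2 first.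
- by rewrite -split01 => t /=; exact: c0.
- apply/disj_setPS => t [/=]; rewrite !in_itv /= => /andP[_ tl] /andP[lt _].
  by rewrite ltNge tl in lt.
have il : 0 <= lam^-1 by rewrite invr_ge0 ltW.
have il' : 0 <= (1 - lam)^-1 by rewrite invr_ge0 ltW.
have D1 : affine lam^-1 0 @^-1` `[0, 1] = `[0, lam]%classic.
  by apply/seteqP; split => t /=; rewrite /affine glue_left01 in_itv.
have D2 : affine (1 - lam)^-1 (1 - (1 - lam)^-1) @^-1` `[0, 1] = `[lam, 1]%classic.
  by apply/seteqP; split => t /=; rewrite /affine glue_right01 in_itv.
have E1 := integral_cost_affine ce1 (invr_neq0 (lt0r_neq0 lam0)) (measurable_itv _) D1.
have E2 := integral_cost_affine ce2 (invr_neq0 (lt0r_neq0 lam1)) (measurable_itv _) D2.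
rewrite (ger0_norm il) in E1; rewrite (ger0_norm il') in E2.
apply: leeD.
- rewrite -E1 le_eqVlt; apply/orP; left; apply/eqP.
  apply: eq_integral => t /set_mem /=; rewrite in_itv /= => /andP[_ tl].
  by rewrite /mu /psi /h /glue tl.
(* The two pieces must be disjoint, so the second is open at [lam]; closing it does not change the
   integral. *)
- rewrite -E2 -integral_itv_obnd_cbnd.
    rewrite le_eqVlt; apply/orP; left; apply/eqP.
    apply: eq_integral => t /set_mem /=; rewrite in_itv /= => /andP[lt _].
    by rewrite /mu /psi /h /glue leNgt lt.
  apply: (@eq_measurable_fun _ _ _ _ _ (fun t => ((1 - lam)^-1 ^+ 2)%:E * (cost K w a b
      (mu2 ((1 - lam)^-1 * t + (1 - (1 - lam)^-1)))
      (psi2 ((1 - lam)^-1 * t + (1 - (1 - lam)^-1)))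
      (h2 ((1 - lam)^-1 * t + (1 - (1 - lam)^-1))))%:E)%E).
    by move=> t _; rewrite cost_scale EFinM.
  have right01 t : (`]lam, 1]%classic : set R) t ->
      (1 - lam)^-1 * t + (1 - (1 - lam)^-1) \in `[0, 1].
    by rewrite glue_right01 /= in_itv /= => /andP[/ltW -> ->].
  have mc2 := measurable_cost_affine ce2 (measurable_itv _) right01.
  by apply: emeasurable_funM; [exact: measurable_cst | exact: mc2].
Qed.

End glue_paths.
End glue.
End triangle.

(** * Near-optimal paths, the triangle inequality and symmetry *)

Section distance.
Context (R : realType) (X : finType) (K : X -> X -> R) (w p : X -> R) (a b : R).
Hypothesis K_ge0 : forall x y, 0 <= K x y.
Hypothesis w_ge0 : forall x, 0 <= w x.
Implicit Types (m : X -> R) (mu psi : R -> X -> R) (h : R -> R).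

Lemma W_le m0 m1 mu psi h (r : R) : CE K p m0 m1 mu psi h -> 0 <= r ->
  (action K w a b mu psi h <= (r ^+ 2)%:E)%E -> (W K w a b p m0 m1 <= r%:E)%E.
Proof.
move=> ce r0 ar.
have -> : r%:E = sqrte (r ^+ 2)%:E by rewrite /= sqrtr_sqr ger0_norm.
rewrite /W lee_sqrt ?lee_fin ?sqr_ge0 //; apply: le_trans ar.
by apply: ereal_inf_lbound; exists mu, psi, h.
Qed.

Lemma W_lt m0 m1 (r : R) : (W K w a b p m0 m1 < r%:E)%E ->
  exists mu psi h, CE K p m0 m1 mu psi h /\
    (action K w a b mu psi h < (r ^+ 2)%:E)%E.
Proof.
move=> Wr.
have r0 : 0 <= r by rewrite -lee_fin; apply: le_trans (ltW Wr); exact: sqrte_ge0.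
have /ereal_inf_lt[_ [mu [psi [h [ce ->]]]] ar] :
    (ereal_inf [set c : \bar R | exists (mu psi : R -> X -> R) (h : R -> R),
      CE K p m0 m1 mu psi h /\ c = action K w a b mu psi h] < (r ^+ 2)%:E)%E.
  rewrite ltNge; apply/negP => rI.
  move: Wr; rewrite /W ltNge => /negP; apply.
  have -> : r%:E = sqrte (r ^+ 2)%:E by rewrite /= sqrtr_sqr ger0_norm.
  rewrite lee_sqrt //.
  by apply: le_trans rI; rewrite lee_fin sqr_ge0.
by exists mu, psi, h.
Qed.

Lemma W_triangle m0 m1 m2 :
  (W K w a b p m0 m2 <= W K w a b p m0 m1 + W K w a b p m1 m2)%E.
Proof.
have W0 m m' : (0 <= W K w a b p m m')%E by exact: sqrte_ge0.
have [W1|W1] := eqVneq (W K w a b p m0 m1) +oo%E.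
  by rewrite W1 addye ?leey // gt_eqF // (lt_le_trans _ (W0 _ _)).
have [W2|W2] := eqVneq (W K w a b p m1 m2) +oo%E.
  by rewrite W2 addey ?leey // gt_eqF // (lt_le_trans _ (W0 _ _)).
have f1 : W K w a b p m0 m1 \is a fin_num by rewrite ge0_fin_numE // ltey.
have f2 : W K w a b p m1 m2 \is a fin_num by rewrite ge0_fin_numE // ltey.
apply/lee_addgt0Pr => eps e0.
(* The margin [eps / 2] provides paths of action below the squares of [r1] and [r2], and makes both
   positive even when a distance is zero, so that the time fraction lies strictly between 0 and
   1. *)
set r1 := fine (W K w a b p m0 m1) + eps / 2.
set r2 := fine (W K w a b p m1 m2) + eps / 2.
have e2 : 0 < eps / 2 by rewrite divr_gt0.
have r1_gt0 : 0 < r1 by rewrite ltr_wpDl // fine_ge0.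
have r2_gt0 : 0 < r2 by rewrite ltr_wpDl // fine_ge0.
have [|mu1 [psi1 [h1 [ce1 a1]]]] := @W_lt m0 m1 r1.
  by rewrite -(fineK f1) lte_fin ltrDl.
have [|mu2 [psi2 [h2 [ce2 a2]]]] := @W_lt m1 m2 r2.
  by rewrite -(fineK f2) lte_fin ltrDl.
(* The time fraction [r1 / (r1 + r2)] minimises [r1 ^ 2 / lam + r2 ^ 2 / (1 - lam)]. *)
pose lam := r1 / (r1 + r2).
have r12 : 0 < r1 + r2 by rewrite addr_gt0.
have lam01 : 0 < lam < 1.
  by rewrite divr_gt0 //= ltr_pdivrMr // mul1r ltrDl.
have l1E : 1 - lam = r2 / (r1 + r2) by rewrite /lam; field; rewrite gt_eqF.
have -> : (W K w a b p m0 m1 + W K w a b p m1 m2 + eps%:E = (r1 + r2)%:E)%E.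
  rewrite -(fineK f1) -(fineK f2) -!EFinD; congr EFin; rewrite /r1 /r2; lra.
apply: (W_le (CE_glue lam01 ce1 ce2)); first exact: ltW.
apply: le_trans (action_glue a b K_ge0 w_ge0 lam01 ce1 ce2) _.
apply: (@le_trans _ _ ((lam^-1)%:E * (r1 ^+ 2)%:E + ((1 - lam)^-1)%:E * (r2 ^+ 2)%:E)%E).
  have [lam0 lam1] := andP lam01.
  apply: leeD; apply: lee_wpmul2l; try exact: ltW.
    by rewrite lee_fin invr_ge0 ltW.
  by rewrite lee_fin invr_ge0 subr_ge0 ltW.
rewrite -!EFinM -EFinD lee_fin l1E /lam le_eqVlt; apply/orP; left; apply/eqP.
by field; rewrite !gt_eqF.
Qed.

Lemma W_symmetric m0 m1 : W K w a b p m0 m1 = W K w a b p m1 m0.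
Proof. by apply/eqP; rewrite eq_le !W_symmetric_le. Qed.

End distance.

(** * Positivity of the steady state *)

Lemma kernel_pow_steady (R : realType) (X : finType) (K : X -> X -> R) (w : X -> R) n y :
  steady_state K w -> w y = \sum_(x : X) w x * kernel_pow K n x y.
Proof.
move=> [_ wK _]; elim: n => [|n IHn] /=.
  rewrite (bigD1 y) //= eqxx mulr1 big1 ?addr0 // => x xy.
  by rewrite (negbTE xy) mulr0.
rewrite IHn; under [RHS]eq_bigr do rewrite mulr_sumr.
rewrite exchange_big /=; apply: eq_bigr => z _.
by rewrite {1}wK mulr_suml; apply: eq_bigr => x _; rewrite mulrA.
Qed.

Lemma kernel_pow_ge0 (R : realType) (X : finType) (K : X -> X -> R) n x y :
  (forall x y, 0 <= K x y) -> 0 <= kernel_pow K n x y.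
Proof.
move=> K0; elim: n x => [|n IHn] x /=; first exact: ler0n.
by apply: sumr_ge0 => z _; rewrite mulr_ge0.
Qed.

(** Total weight 1 forces a positive weight at some [x]. Irreducibility gives a power of [K] leading
    from [x] to [y], and invariance under that power transports the weight. *)
Lemma steady_state_gt0 (R : realType) (X : finType) (K : X -> X -> R) (w : X -> R) y :
  (forall x y, 0 <= K x y) -> irreducible_kernel K -> steady_state K w -> 0 < w y.
Proof.
move=> K0 irr ss; have [w0 _ w1] := ss.
have [x wx] : exists x, 0 < w x.
  apply/existsP; apply: contraT => /existsPn wN.
  have : \sum_(x : X) w x = 0.
    apply: big1 => x _; apply/eqP; rewrite eq_le w0 andbT.
    by have := wN x; rewrite -leNgt.
  by rewrite w1 => /eqP; rewrite oner_eq0.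
have [n Kn] := irr x y.
rewrite (kernel_pow_steady n y ss) (bigD1 x) //=.
by rewrite ltr_wpDr ?mulr_gt0 // sumr_ge0 // => z _; rewrite mulr_ge0 // kernel_pow_ge0.
Qed.

Lemma is_derive_weighted_sum (R : realType) (X : finType) (c : X -> R) (F : X -> R -> R)
    (dF : X -> R) (t : R) : (forall x, is_derive t 1 (F x) (dF x)) ->
  is_derive t 1 (fun s => \sum_x c x * F x s) (\sum_x c x * dF x).
Proof.
move=> dFt; elim: (index_enum X) => [|x l IHl].
  rewrite big_nil (_ : (fun _ => _) = cst 0); first exact: is_derive_cst.
  by apply/funext => s; rewrite big_nil.
rewrite big_cons (_ : (fun _ => _) = (c x *: F x) + (fun s => \sum_(j <- l) c j * F j s)).
  exact: is_deriveD.
by apply/funext => s; rewrite big_cons.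
Qed.

(** * Distance zero forces equality *)

Section separation.
Context (R : realType) (X : finType) (K : X -> X -> R) (w p : X -> R) (a b : R).
Hypothesis K_ge0 : forall x y, 0 <= K x y.
Hypothesis K_sum1 : forall x, \sum_(y : X) K x y = 1.
Hypothesis w_gt0 : forall x, 0 < w x.
Hypothesis w_rev : reversible_for K w.
Hypothesis a_gt0 : 0 < a.
Hypothesis b_gt0 : 0 < b.
Hypothesis p_gt0 : forall x, 0 < p x.
Hypothesis p_norm : \sum_(x : X) w x * p x = 1.
Implicit Types (m f : X -> R) (mu psi : R -> X -> R) (h : R -> R) (t k : R).
Local Notation leb := (@lebesgue_measure R).

Let w_ge0 x : 0 <= w x. Proof. exact: ltW. Qed.

Definition mass m : R := \sum_(x : X) w x * m x.

(* By reversibility and the symmetry of the mean the flux is antisymmetric. *)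
Lemma mass_flux m f : nonneg_densities m ->
  \sum_(x : X) w x * \sum_(y : X) (f y - f x) * hat m x y * K x y = 0.
Proof.
move=> m0; set S := LHS.
have SE : S = \sum_x \sum_y (f y - f x) * hat m x y * (K x y * w x).
  apply: eq_bigr => x _; rewrite mulr_sumr; apply: eq_bigr => y _; ring.
suff : S = - S by lra.
rewrite {1}SE exchange_big SE -sumrN; apply: eq_bigr => x _.
rewrite -sumrN; apply: eq_bigr => y _.
rewrite w_rev (_ : hat m y x = hat m x y); first by ring.
by apply: log_meanC; exact: m0.
Qed.

Lemma mass_derive mu psi h t : nonneg_densities (mu t) -> flow_at K p mu psi h t ->
  derivable (fun s => mass (mu s)) t 1 /\ derive1 (fun s => mass (mu s)) t = h t.
Proof.
move=> mu0 flow.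
have /(is_derive_weighted_sum w) [d1 d2] :
    forall x, is_derive t 1 (fun s => mu s x) (derive1 (fun s => mu s x) t).
  by move=> x; have [dmu _] := flow x; rewrite derive1E; split.
split => //; rewrite derive1E d2.
rewrite (eq_bigr (fun x => h t * (w x * p x) -
    w x * \sum_(y : X) (psi t y - psi t x) * hat (mu t) x y * K x y)); last first.
  by move=> x _; have [_ e] := flow x; rewrite mulrCA -e; ring.
by rewrite big_split sumrN /= mass_flux // subr0 -mulr_sumr p_norm mulr1.
Qed.

Lemma cost_ge_source m f r : nonneg_densities m -> r ^+ 2 <= a ^- 2 * cost K w a b m f r.
Proof.
move=> m0; rewrite mulrC ler_pdivlMr ?exprn_gt0 // mulrC lerDl.
by rewrite mulr_ge0 ?sqr_ge0 // energy_ge0.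
Qed.

(** Only row [x] of the double sum is kept; the constant undoes the factors 1/2, [w x] and b^2. *)
Lemma cost_ge_energy m f r x : nonneg_densities m ->
  \sum_(y : X) (f y - f x) ^+ 2 * hat m x y * K x y <=
    2 / (w x * b ^+ 2) * cost K w a b m f r.
Proof.
move=> m0.
rewrite mulrAC ler_pdivlMr ?mulr_gt0 ?exprn_gt0 //.
have ge0 x' y : 0 <= (f y - f x') ^+ 2 * hat m x' y * K x' y * w x'.
  by rewrite mulr_ge0 // mulr_ge0 // mulr_ge0 ?sqr_ge0 // hat_ge0.
have : \sum_(y : X) (f y - f x) ^+ 2 * hat m x y * K x y * w x <=
    \sum_(x' : X) \sum_(y : X) (f y - f x') ^+ 2 * hat m x' y * K x' y * w x'.
  rewrite [leRHS](bigD1 x) //= lerDl; apply: sumr_ge0 => x' _.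
  exact: sumr_ge0.
rewrite -mulr_suml; set D := \sum_(y : X) \sum_(z : X) _; set S := \sum_(y : X) _ => SD.
have -> : 2 * cost K w a b m f r = 2 * (a ^+ 2 * r ^+ 2) + D * b ^+ 2.
  by rewrite /cost -/D; field.
have a2 : 0 <= 2 * (a ^+ 2 * r ^+ 2) by rewrite mulr_ge0 // mulr_ge0 ?sqr_ge0.
have : S * w x * b ^+ 2 <= D * b ^+ 2 by rewrite ler_pM2r // exprn_gt0.
by rewrite mulrA; lra.
Qed.

Lemma integral_cost_linear m0 m1 mu psi h (al be : R) : CE K p m0 m1 mu psi h ->
  0 <= al -> 0 <= be ->
  (\int[leb]_(t in `[0%R, 1%R]) (al * cost K w a b (mu t) (psi t) (h t) + be)%:E =
    al%:E * action K w a b mu psi h + be%:E)%E.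
Proof.
move=> ce al0 be0; rewrite (action_cost a b K_ge0 w_ge0 ce).
have mc : measurable_fun (`[0, 1] : set R) (fun t => cost K w a b (mu t) (psi t) (h t)).
  exact: CE_measurable_cost ce.
have c0 t : t \in `[0, 1] -> 0 <= cost K w a b (mu t) (psi t) (h t).
  by move=> tI; apply: cost_ge0 => //; exact: (CE_nonneg ce).
under eq_integral do rewrite EFinD EFinM.
rewrite ge0_integralD //; last 2 first.
- by move=> t tI; rewrite -EFinM lee_fin mulr_ge0 // c0.
- by apply/measurable_EFinP; apply: measurable_funM.
rewrite ge0_integralZl_EFin //; last exact/measurable_EFinP.
by rewrite integral_cst //= lebesgue_measure_itv /= lte_fin ltr01 oppr0 adde0 mule1.
Qed.

(** The mass has derivative h, and |h| <= h^2 + 1 <= a^-2 cost + 1. Integrating with action at most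
    1 gives the constant. *)
Lemma mass_bound m0 m1 mu psi h t : CE K p m0 m1 mu psi h ->
  (action K w a b mu psi h <= 1)%E -> t \in `[0, 1] ->
  mass (mu t) <= mass m0 + (a ^- 2 + 1).
Proof.
move=> ce a1 tI.
have ia : 0 <= a ^- 2 by rewrite invr_ge0 sqr_ge0.
have /andP[t0 t1] : 0 <= t <= 1 by rewrite in_itv in tI.
have sub01 s : s \in `[0, t] -> s \in `[0, 1].
  by rewrite !in_itv /= => /andP[-> /le_trans ->].
pose g s := a ^- 2 * cost K w a b (mu s) (psi s) (h s) + 1.
have g0 s : s \in `[0, 1] -> 0 <= g s.
  by move=> sI; rewrite addr_ge0 // mulr_ge0 // cost_ge0 //; exact: (CE_nonneg ce).
have mg : measurable_fun (`[0, 1] : set R) g.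
  by apply: measurable_funD => //; apply: measurable_funM => //; exact: CE_measurable_cost ce.
have massac : abs_continuous_on 0 1 (fun s => mass (mu s)).
  by apply: abs_continuous_on_sum => x; apply: abs_continuous_onZ; exact: CE_abs_continuous ce x.
have bound : (`|mass (mu t) - mass (mu 0)|%:E <= \int[leb]_(s in `[0%R, t]) (g s)%:E)%E.
  apply: (abs_continuous_on_le_integral t0 (f := fun s => mass (mu s))).
  - exact: abs_continuous_on_sub massac.
  - by apply: (measurable_funS _ _ mg) => // s; exact: sub01.
  - by move=> s /sub01; exact: g0.
  - apply: (@filterS _ _ (ae_filter_ringOfSetsType leb)) (CE_equation ce) => s flow sI.
    have s01 := sub01 _ sI; have mus := CE_nonneg ce s01.
    have [d1 d2] := mass_derive mus (flow s01).
    split => //; rewrite d2 /g.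
    have := cost_ge_source (psi s) (h s) mus.
    suff : `|h s| <= h s ^+ 2 + 1 by lra.
    by rewrite -[h s ^+ 2]real_normK ?num_real //; nra.
have : (`|mass (mu t) - mass (mu 0)|%:E <= (a ^- 2 + 1)%:E)%E.
  apply: (le_trans bound).
  apply: (@le_trans _ _ (\int[leb]_(s in `[0%R, 1%R]) (g s)%:E)%E).
    apply: ge0_subset_integral => //; exact/measurable_EFinP.
  rewrite (integral_cost_linear ce) // EFinD leeD2r //.
  by rewrite -[leRHS]mule1; apply: lee_wpmul2l.
by rewrite lee_fin (CE_start ce) ler_norml => /andP[_]; lra.
Qed.

Lemma W_eq0_eq m0 m1 : nonneg_densities m0 -> W K w a b p m0 m1 = 0%E -> m0 = m1.
Proof.
move=> m00 W0; apply/funext => x; apply/eqP; rewrite eq_sym -subr_eq0 -normr_eq0.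
rewrite eq_le normr_ge0 andbT; apply/ler_addgt0Pr => eps e0; rewrite add0r.
have mass0 : 0 <= mass m0 by apply: sumr_ge0 => y _; rewrite mulr_ge0 //; exact: m00.
have ia : 0 <= a ^- 2 by rewrite invr_ge0 sqr_ge0.
pose B := mass m0 + (a ^- 2 + 1).
have B0 : 0 <= B by rewrite /B; lra.
(* Each [w y * mu t y] is at most the mass, so [B / w y] bounds the density at [y]; the sum over [y]
   is a bound common to all points. *)
pose M := \sum_(y : X) B / w y.
have BM y : B / w y <= M.
  rewrite /M (bigD1 y) //= lerDl; apply: sumr_ge0 => z _; exact: divr_ge0.
have M0 : 0 <= M by apply: sumr_ge0 => z _; exact: divr_ge0.
(* The first two terms are the coefficients of cost / r from the source and from the flux; the last
   two are the matching coefficients of r. *)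
pose C := p x * a ^- 2 + 2 / (w x * b ^+ 2) + p x + M.
have C1 : 0 <= 2 / (w x * b ^+ 2) by rewrite divr_ge0 // mulr_ge0 ?sqr_ge0.
have C0 : 0 < C.
  have := p_gt0 x; have : 0 <= p x * a ^- 2 by rewrite mulr_ge0 // ltW.
  rewrite /C; lra.
(* The bound 1 keeps the action at most 1, as [mass_bound] requires; the other makes the final
   estimate [2 * C * r] at most [eps]. *)
pose r := Num.min 1 (eps / (2 * C)).
have r0 : 0 < r by rewrite lt_min ltr01 divr_gt0 // mulr_gt0.
have r1 : r <= 1 by rewrite ge_min lexx.
have rC : 2 * C * r <= eps.
  by rewrite mulrC -ler_pdivlMr ?mulr_gt0 // ge_min lexx orbT.
have [|mu [psi [h [ce ar]]]] := @W_lt R X K w p a b m0 m1 r.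
  by rewrite W0 lte_fin.
have a1 : (action K w a b mu psi h <= 1)%E.
  by apply: (le_trans (ltW ar)); rewrite lee_fin expr_le1 // ltW.
have muM t y : t \in `[0, 1] -> mu t y <= M.
  move=> tI; apply: le_trans (BM y); rewrite ler_pdivlMr //.
  apply: le_trans (mass_bound ce a1 tI); rewrite /mass (bigD1 y) //= mulrC lerDl.
  by apply: sumr_ge0 => z _; rewrite mulr_ge0 //; exact: (CE_nonneg ce).
pose c := r^-1; have c0 : 0 < c by rewrite invr_gt0.
have cr : c * r = 1 by rewrite mulVf // gt_eqF.
have amgm (u : R) : `|u| <= c * u ^+ 2 + r.
  rewrite -[u ^+ 2]real_normK ?num_real //.
  move: `|u| => v; rewrite -subr_ge0.
  have -> : c * v ^+ 2 + r - v = c * v ^+ 2 + r * (c * r) - v * (c * r) by rewrite cr !mulr1.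
  (* Completing the square, with [c * r = 1]. *)
  rewrite (_ : _ - _ = c * ((v - r / 2) ^+ 2 + 3 / 4 * r ^+ 2)); last by field.
  by rewrite mulr_ge0 ?(ltW c0) // addr_ge0 ?sqr_ge0 // mulr_ge0 ?sqr_ge0 //.
pose g t := (C * c) * cost K w a b (mu t) (psi t) (h t) + C * r.
have Cc0 : 0 <= C * c by rewrite mulr_ge0 // ltW.
have Cr0 : 0 <= C * r by rewrite mulr_ge0 // ltW.
have bound : (`|mu 1 x - mu 0 x|%:E <= \int[leb]_(s in `[0%R, 1%R]) (g s)%:E)%E.
  apply: (abs_continuous_on_le_integral ler01 (f := fun s => mu s x)).
  - exact: CE_abs_continuous ce x.
  - by apply: measurable_funD => //; apply: measurable_funM => //; exact: CE_measurable_cost ce.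
  - move=> s sI; rewrite addr_ge0 // mulr_ge0 // cost_ge0 //; exact: (CE_nonneg ce).
  - apply: (@filterS _ _ (ae_filter_ringOfSetsType leb)) (CE_equation ce) => s flow sI.
    have [d1 d2] := flow sI x; split => //; have mus := CE_nonneg ce sI.
    have -> : derive1 (fun s => mu s x) s = h s * p x -
      \sum_(y : X) (psi s y - psi s x) * hat (mu s) x y * K x y by rewrite -d2 addrK.
    have hb := cost_ge_source (psi s) (h s) mus.
    have eb := cost_ge_energy (psi s) (h s) x mus.
    have cc := cost_ge0 a b K_ge0 w_ge0 (psi s) (h s) mus.
    move: hb eb cc; rewrite /g; set c_s := cost _ _ _ _ _ _ _ => hb eb cc.
    apply: (le_trans (ler_normB _ _)).
    have h1 : `|h s * p x| <= p x * (c * (a ^- 2 * c_s) + r).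
      rewrite normrM (gtr0_norm (p_gt0 x)) mulrC ler_pM2l //.
      apply: (le_trans (amgm _)); rewrite lerD2r ler_pM2l //.
    have h2 : `|\sum_(y : X) (psi s y - psi s x) * hat (mu s) x y * K x y| <=
        c * (2 / (w x * b ^+ 2) * c_s) + M * r.
      apply: (le_trans (ler_norm_sum _ _ _)).
      (* The quadratic bound is applied to each potential difference under the weight hat K; in the
         remainder hat is at most [M], and the rows of [K] sum to 1. *)
      apply: (@le_trans _ _ (\sum_(y : X) (c * ((psi s y - psi s x) ^+ 2 * hat (mu s) x y * K x y)
         + M * r * K x y))).
        apply: ler_sum => y _.
        have th0 : 0 <= hat (mu s) x y by exact: hat_ge0.
        have thM : hat (mu s) x y <= M.
          by apply: log_mean_le; rewrite muM // andbT; exact: mus.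
        rewrite !normrM (ger0_norm th0) (ger0_norm (K_ge0 x y)) (mulrA c) (mulrA c (_ ^+ 2)) -mulrDl.
        apply: ler_wpM2r => //.
        apply: (le_trans (ler_wpM2r th0 (amgm _))); rewrite mulrDl lerD2l.
        by rewrite [r * _]mulrC ler_wpM2r // ltW.
      by rewrite big_split /= -!mulr_sumr K_sum1 mulr1 lerD2r ler_pM2l.
    apply: (le_trans (lerD h1 h2)).
    have -> : C * c * c_s + C * r = p x * (c * (a ^- 2 * c_s) + r) +
      (c * (2 / (w x * b ^+ 2) * c_s) + M * r) + ((p x + M) * c * c_s
       + (p x * a ^- 2 + 2 / (w x * b ^+ 2)) * r) by rewrite /C; ring.
    have [px cw rw] : [/\ 0 <= p x, 0 <= c & 0 <= r] by rewrite !ltW.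
    by rewrite lerDl addr_ge0 // mulr_ge0 // ?mulr_ge0 // addr_ge0 // mulr_ge0.
have : (`|mu 1 x - mu 0 x|%:E <= eps%:E)%E.
  apply: (le_trans bound); rewrite (integral_cost_linear ce) //.
  apply: (@le_trans _ _ ((C * c)%:E * (r ^+ 2)%:E + (C * r)%:E)%E).
    by apply: leeD => //; apply: lee_wpmul2l; rewrite ?lee_fin //; exact: ltW.
  rewrite -EFinM -EFinD lee_fin (_ : C * c * r ^+ 2 + C * r = 2 * C * r) //.
  by rewrite expr2 mulrA -[C * c * r]mulrA cr; ring.
by rewrite lee_fin (CE_start ce) (CE_end ce).
Qed.

End separation.

(** * Continuity of determinants and of Cramer's rule *)

Section continuity_of_algebraic_expressions.
Context (R : realType).

Lemma continuous_at_sum (I : finType) (F : I -> R -> R) (t : R) :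
  (forall i, {for t, continuous (F i)}) -> {for t, continuous (fun s => \sum_i F i s)}.
Proof.
move=> cF; elim: (index_enum I) => [|i l IHl].
  rewrite (_ : (fun _ => _) = cst 0); first exact: cst_continuous.
  by apply/funext => s; rewrite big_nil.
rewrite (_ : (fun _ => _) = fun s => F i s + \sum_(j <- l) F j s).
  exact: cvgD (cF i) IHl.
by apply/funext => s; rewrite big_cons.
Qed.

Lemma continuous_at_prod (I : finType) (F : I -> R -> R) (t : R) :
  (forall i, {for t, continuous (F i)}) -> {for t, continuous (fun s => \prod_i F i s)}.
Proof.
move=> cF; elim: (index_enum I) => [|i l IHl].
  rewrite (_ : (fun _ => _) = cst 1); first exact: cst_continuous.
  by apply/funext => s; rewrite big_nil.
rewrite (_ : (fun _ => _) = fun s => F i s * \prod_(j <- l) F j s).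
  exact: cvgM (cF i) IHl.
by apply/funext => s; rewrite big_cons.
Qed.

Lemma continuous_at_det n (A : R -> 'M[R]_n) (t : R) :
  (forall i j, {for t, continuous (fun s => A s i j)}) ->
  {for t, continuous (fun s => \det (A s))}.
Proof.
move=> cA; apply: continuous_at_sum => sg; apply: cvgMr.
by apply: continuous_at_prod => i; exact: cA.
Qed.

(** Cramer's rule gives the solution of a linear system as a quotient of polynomials in its entries,
    so continuity can fail only where the determinant vanishes. *)
Lemma continuous_at_cramer n (A : R -> 'M[R]_n) (u : 'rV[R]_n) (t : R) j :
  (forall i j, {for t, continuous (fun s => A s i j)}) -> \det (A t) != 0 ->
  {for t, continuous (fun s => ((\det (A s))^-1 *: (u *m \adj (A s))) 0 j)}.
Proof.
move=> cA dA.
rewrite (_ : (fun s => _) = fun s => (\det (A s))^-1 *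
    \sum_i u 0 i * ((-1) ^+ (j + i) * \det (row' j (col' i (A s))))); last first.
  by apply/funext => s; rewrite !mxE; congr (_ * _); apply: eq_bigr => i _; rewrite !mxE.
apply: cvgM; first exact: cvgV dA (continuous_at_det cA).
apply: continuous_at_sum => i; do 2 apply: cvgMr.
apply: continuous_at_det => k l; rewrite (_ : (fun _ => _) =
  fun s => A s (lift j k) (lift i l)); first exact: cA.
by apply/funext => s; rewrite !mxE.
Qed.

End continuity_of_algebraic_expressions.

(* The rank-one term [w y] makes the weighted graph Laplacian invertible: it pins down
   the additive constant left free by the gradient. *)
Definition pinned_laplacian (R : realType) (X : finType) (w : X -> R) (c : X -> X -> R) :
    'M[R]_#|X| :=
  \matrix_(i, j) let y := enum_val i in let x := enum_val j in
    w y - c x y + (x == y)%:R * \sum_(z : X) c x z.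

(** * Solvability of the Poisson equation on a weighted graph *)

Section poisson_equation.
Context (R : realType) (X : finType) (w : X -> R) (c : X -> X -> R).
Hypothesis w_ge0 : forall x, 0 <= w x.
Hypothesis w_sum1 : \sum_x w x = 1.
Hypothesis c_ge0 : forall x y, 0 <= c x y.
Hypothesis c_sym : forall x y, w x * c x y = w y * c y x.

Lemma pinned_laplacianE (v : 'rV[R]_#|X|) x :
  (v *m pinned_laplacian w c) 0 (enum_rank x) =
  \sum_(y : X) w y * v 0 (enum_rank y) +
  \sum_(y : X) (v 0 (enum_rank x) - v 0 (enum_rank y)) * c x y.
Proof.
rewrite mxE (reindex (@enum_rank X)) /=; last exact/onW_bij/enum_rank_bij.
set D := \sum_(z : X) c x z; pose f y := v 0 (enum_rank y).
rewrite (eq_bigr (fun y => w y * f y + (f y * ((x == y)%:R * D) - f y * c x y))); last first.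
  by move=> y _; rewrite mxE /= !enum_rankK -/(f y) -/D; ring.
rewrite big_split; congr (_ + _); rewrite sumrB (bigD1 x) //= eqxx mul1r.
rewrite [X in _ + X - _]big1 ?addr0 => [|y yx]; last first.
  by rewrite eq_sym (negbTE yx) mul0r mulr0.
by rewrite mulr_sumr -sumrB; apply: eq_bigr => y _; rewrite mulrBl.
Qed.

Lemma weighted_laplacian_sum0 (f : X -> R) :
  \sum_x w x * \sum_y (f x - f y) * c x y = 0.
Proof.
set S := LHS.
have SE : S = \sum_x \sum_y (w x * c x y) * (f x - f y).
  by apply: eq_bigr => x _; rewrite mulr_sumr; apply: eq_bigr => y _; ring.
suff : S = - S by lra.
rewrite {1}SE exchange_big SE -sumrN; apply: eq_bigr => x _.
by rewrite -sumrN; apply: eq_bigr => y _; rewrite c_sym; ring.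
Qed.

(** Discrete integration by parts: exchanging x and y and averaging turns f x into half of f x - f
    y. *)
Lemma weighted_laplacian_energy (f : X -> R) :
  2 * \sum_x w x * f x * \sum_y (f x - f y) * c x y =
  \sum_x \sum_y w x * c x y * (f x - f y) ^+ 2.
Proof.
set S := (X in 2 * X = _).
have SE : S = \sum_x \sum_y (w x * c x y) * ((f x - f y) * f x).
  by apply: eq_bigr => x _; rewrite mulr_sumr; apply: eq_bigr => y _; ring.
rewrite mulr_natl mulr2n {1}SE exchange_big /= SE -big_split; apply: eq_bigr => x _ /=.
by rewrite -big_split; apply: eq_bigr => y _ /=; rewrite c_sym; ring.
Qed.

(** Connectedness of the graph of conductances, stated as needed: a function of zero Dirichlet
    energy is constant. *)
Hypothesis harmonic_const : forall f : X -> R,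
  (forall x y, w x * c x y * (f x - f y) ^+ 2 = 0) -> forall x y, f x = f y.

(** Summing the equation of a kernel vector against [w] cancels the Laplacian, so the mean is zero.
    The Laplacian is then zero as well, hence so is the energy, and a constant of mean zero
    vanishes. *)
Lemma det_pinned_laplacian : \det (pinned_laplacian w c) != 0.
Proof.
apply/det0P => -[v v0 vA]; move/negP: v0; apply; apply/eqP.
pose f x := v 0 (enum_rank x).
have eq0 x : \sum_(y : X) w y * f y + \sum_(y : X) (f x - f y) * c x y = 0.
  by rewrite -pinned_laplacianE vA mxE.
have wf0 : \sum_(y : X) w y * f y = 0.
  have : \sum_x w x * (\sum_(y : X) w y * f y + \sum_(y : X) (f x - f y) * c x y) = 0.
    by rewrite big1 // => x _; rewrite eq0 mulr0.
  under eq_bigr do rewrite mulrDr.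
  by rewrite big_split /= weighted_laplacian_sum0 addr0 -mulr_suml w_sum1 mul1r => ->.
have lap0 x : \sum_(y : X) (f x - f y) * c x y = 0 by have := eq0 x; rewrite wf0 add0r.
have E0 : \sum_x \sum_y w x * c x y * (f x - f y) ^+ 2 = 0.
  by rewrite -weighted_laplacian_energy big1 ?mulr0 // => x _; rewrite lap0 mulr0.
have term_ge0 x y : 0 <= w x * c x y * (f x - f y) ^+ 2.
  by rewrite mulr_ge0 ?sqr_ge0 // mulr_ge0.
have fconst : forall x y, f x = f y.
  apply: harmonic_const => x y.
  have /psumr_eq0P E1 : \sum_y w x * c x y * (f x - f y) ^+ 2 = 0.
    move/psumr_eq0P : E0; apply => // z _; exact: sumr_ge0.
  by apply: E1.
apply/rowP => j; rewrite mxE -[j]enum_valK -/(f _); set x := enum_val j.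
rewrite -wf0 (eq_bigr (fun y => w y * f x)) -?mulr_suml ?w_sum1 ?mul1r //.
by move=> y _; rewrite (fconst y x).
Qed.

(** The pinned system solves mean plus Laplacian = u. Since [u] has mean zero, summing against [w]
    shows that the mean of the solution is zero too. *)
Lemma poisson_solution (u : 'rV[R]_#|X|) :
  let v := (\det (pinned_laplacian w c))^-1 *: (u *m \adj (pinned_laplacian w c)) in
  \sum_x w x * u 0 (enum_rank x) = 0 ->
  forall x, \sum_y (v 0 (enum_rank x) - v 0 (enum_rank y)) * c x y = u 0 (enum_rank x).
Proof.
move=> v u0 x.
have vA : v *m pinned_laplacian w c = u.
  rewrite /v -scalemxAl -mulmxA mul_adj_mx mul_mx_scalar scalerA mulVf ?scale1r //.
  exact: det_pinned_laplacian.
have E y : u 0 (enum_rank y) = \sum_(y : X) w y * v 0 (enum_rank y) +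
    \sum_(z : X) (v 0 (enum_rank y) - v 0 (enum_rank z)) * c y z.
  by rewrite -pinned_laplacianE vA.
suff : \sum_(y : X) w y * v 0 (enum_rank y) = 0 by move=> h; rewrite E h add0r.
move: u0; under eq_bigr do rewrite E mulrDr.
rewrite big_split /= (weighted_laplacian_sum0 (fun x => v 0 (enum_rank x))) addr0.
by rewrite -mulr_suml w_sum1 mul1r.
Qed.

End poisson_equation.

(** A positive entry of a power of [K] comes from a path of positive steps, along which [f] keeps
    its value. *)
Lemma kernel_pow_const (R : realType) (X : finType) (K : X -> X -> R) (f : X -> R) n x y :
  (forall x y, 0 <= K x y) -> (forall x y, 0 < K x y -> f x = f y) ->
  0 < kernel_pow K n x y -> f x = f y.
Proof.
move=> K0 Kf; elim: n x => [|n IHn] x /=.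
  by have [->//|] := eqVneq x y; rewrite ltxx.
move=> Kn; have [z Kz] : exists z, 0 < K x z * kernel_pow K n z y.
  apply/existsP; apply: contraLR Kn => /existsPn KN; rewrite -leNgt.
  by apply: sumr_le0 => z _; have := KN z; rewrite -leNgt.
have Kxz : 0 < K x z.
  rewrite lt_neqAle K0 andbT; apply/eqP => h.
  by move: Kz; rewrite -h mul0r ltxx.
by rewrite (Kf x z Kxz); apply: IHn; move: Kz; rewrite pmulr_rgt0.
Qed.

Lemma abs_continuous_on_id (R : realType) (c d : R) : abs_continuous_on c d id.
Proof.
move=> eps e0; exists eps => // n s t st _; apply: le_lt_trans.
by apply: ler_sum => i _; rewrite ger0_norm // subr_ge0; have [_ []] := st i.
Qed.

(** * Every two densities are at finite distance *)

Section finiteness.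
Context (R : realType) (X : finType) (K : X -> X -> R) (w p : X -> R) (a b : R).
Hypothesis K_ge0 : forall x y, 0 <= K x y.
Hypothesis K_irr : irreducible_kernel K.
Hypothesis w_gt0 : forall x, 0 < w x.
Hypothesis w_sum1 : \sum_x w x = 1.
Hypothesis w_rev : reversible_for K w.
Hypothesis p_gt0 : forall x, 0 < p x.
Hypothesis p_norm : \sum_(x : X) w x * p x = 1.
Implicit Types (m f : X -> R) (mu psi : R -> X -> R) (h : R -> R) (t k : R).
Local Notation leb := (@lebesgue_measure R).

Let w_ge0 x : 0 <= w x. Proof. exact: ltW. Qed.

Lemma W_lty m0 m1 mu psi h (M : R) : CE K p m0 m1 mu psi h ->
  (forall t, t \in `[0, 1] -> cost K w a b (mu t) (psi t) (h t) <= M) ->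
  (W K w a b p m0 m1 < +oo)%E.
Proof.
move=> ce cM.
have M0 : 0 <= M.
  have h0 : (0 : R) \in `[0, 1] by rewrite in_itv /= lexx ler01.
  apply: le_trans (cM 0 h0); apply: cost_ge0 => //; exact: (CE_nonneg ce).
have : (action K w a b mu psi h <= (Num.sqrt M ^+ 2)%:E)%E.
  rewrite (action_cost a b K_ge0 w_ge0 ce) sqr_sqrtr //.
  apply: (@le_trans _ _ (\int[leb]_(t in `[0%R, 1%R]) M%:E)%E).
    apply: ge0_le_integral => //.
    - by move=> t tI; rewrite lee_fin cost_ge0 //; exact: (CE_nonneg ce).
    - by apply/measurable_EFinP; exact: CE_measurable_cost ce.
  by rewrite integral_cst //= lebesgue_measure_itv /= lte_fin ltr01 oppr0 adde0 mule1.
by move=> /(W_le ce (sqrtr_ge0 _)) /le_lt_trans; apply; exact: ltry.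
Qed.

Definition segment m0 m1 t x : R := m0 x + t * (m1 x - m0 x).

Lemma segment_gt0 m0 m1 t : pos_densities m0 -> pos_densities m1 -> t \in `[0, 1] ->
  pos_densities (segment m0 m1 t).
Proof.
move=> m0p m1p; rewrite in_itv /= => /andP[t0 t1] x.
have := m0p x; have := m1p x; rewrite /segment.
have -> : m0 x + t * (m1 x - m0 x) = (1 - t) * m0 x + t * m1 x by ring.
have [->|tn0] := eqVneq t 0; first by rewrite subr0 mul1r mul0r addr0.
move=> h1 h0; rewrite ltr_wpDl ?mulr_gt0 // ?mulr_ge0 ?subr_ge0 //; first exact: ltW.
by rewrite lt_neqAle eq_sym tn0.
Qed.

Lemma segment_derive m0 m1 t x :
  derivable (fun s => segment m0 m1 s x) t 1 /\
  derive1 (fun s => segment m0 m1 s x) t = m1 x - m0 x.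
Proof.
have [d1 d2] : is_derive t 1 (fun s => segment m0 m1 s x) (m1 x - m0 x).
  have -> : (fun s => segment m0 m1 s x) = (m1 x - m0 x) *: id + cst (m0 x).
    by apply/funext => s; rewrite /segment addrC mulrC.
  by apply: is_derive_eq; rewrite addr0 /GRing.scale /= mulr1.
by split => //; rewrite derive1E.
Qed.

Lemma segment_continuous m0 m1 t x : {for t, continuous (fun s => segment m0 m1 s x)}.
Proof. by apply: cvgD; [exact: cvg_cst | apply: cvgMl; exact: cvg_id]. Qed.

Lemma segment_abs_continuous m0 m1 x : abs_continuous_on 0 1 (fun s => segment m0 m1 s x).
Proof.
apply: abs_continuous_onD; first exact: abs_continuous_on_cst.
rewrite (_ : (fun _ => _) = fun t => (m1 x - m0 x) * id t); last first.
  by apply/funext => t; rewrite mulrC.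
by apply: abs_continuous_onZ; exact: abs_continuous_on_id.
Qed.

Lemma continuous_measurable01 (f : R -> R) :
  (forall t, t \in `[0, 1] -> {for t, continuous f}) ->
  measurable_fun (`[0, 1] : set R) f.
Proof.
move=> cf; apply: subspace_continuous_measurable_fun => //.
by apply: continuous_in_subspaceT => t /set_mem; exact: cf.
Qed.

Lemma W_source_lty m : nonneg_densities m ->
  (W K w a b p m (fun x => m x + p x)%R < +oo)%E.
Proof.
move=> m0; pose m1 x := m x + p x.
have ce : CE K p m m1 (segment m m1) (fun _ _ => 0) (fun=> 1).
  split => //.
  - move=> t; rewrite in_itv /= => /andP[t0 t1] x; rewrite /segment /m1 [m x + p x]addrC addrK.
    by rewrite addr_ge0 // mulr_ge0 // ltW.
  - exact: segment_abs_continuous.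
  - apply: aeW => t _ x; have [d1 d2] := segment_derive m m1 t x; split => //.
    rewrite d2 big1 => [|y _]; last by rewrite subrr !mul0r.
    by rewrite /m1 [m x + p x]addrC addrK addr0 mul1r.
  - by apply/funext => x; rewrite /segment mul0r addr0.
  - by apply/funext => x; rewrite /segment mul1r addrC subrK.
apply: (W_lty (M := a ^+ 2) ce) => t _; rewrite /cost expr1n mulr1.
rewrite big1 => [|x _]; first by rewrite !mulr0 addr0.
by rewrite big1 // => y _; rewrite subrr expr0n /= !mul0r.
Qed.

Section segment_potential.
Variables (m0 m1 : X -> R).
Hypothesis m0_gt0 : pos_densities m0.
Hypothesis m1_gt0 : pos_densities m1.

Let mu := segment m0 m1.
(** The change of total mass is assigned to the source: as [p] has mean 1, subtracting [rate * p]
    leaves a right-hand side of mean zero, the solvability condition of the Poisson equation. *)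
Let rate : R := \sum_x w x * (m1 x - m0 x).
Let source : 'rV[R]_#|X| :=
  \row_j (m1 (enum_val j) - m0 (enum_val j) - rate * p (enum_val j)).
Let conductance t x y : R := hat (mu t) x y * K x y.
Let lap t := pinned_laplacian w (conductance t).

(** Given by Cramer's rule rather than chosen at each time, so that it inherits continuity, hence
    measurability, from the conductances. *)
Definition segment_potential t x : R :=
  ((\det (lap t))^-1 *: (source *m \adj (lap t))) 0 (enum_rank x).

Let mu_gt0 t : t \in `[0, 1] -> pos_densities (mu t).
Proof. exact: segment_gt0. Qed.

Let conductance_ge0 t x y : t \in `[0, 1] -> 0 <= conductance t x y.
Proof.
by move=> tI; rewrite mulr_ge0 // log_mean_ge0 // ltW //; exact: mu_gt0.
Qed.

Let conductance_sym t x y : t \in `[0, 1] ->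
  w x * conductance t x y = w y * conductance t y x.
Proof.
move=> tI.
have -> : w x * conductance t x y = hat (mu t) x y * (K x y * w x).
  by rewrite mulrC -mulrA.
have -> : w y * conductance t y x = hat (mu t) y x * (K y x * w y).
  by rewrite mulrC -mulrA.
have <- : hat (mu t) x y = hat (mu t) y x by apply: log_meanC; apply: ltW; exact: mu_gt0.
by rewrite w_rev.
Qed.

Let harmonic_const t f : t \in `[0, 1] ->
  (forall x y, w x * conductance t x y * (f x - f y) ^+ 2 = 0) -> forall x y, f x = f y.
Proof.
move=> tI f0 x y; have [n] := K_irr x y; apply: kernel_pow_const => // x' y' Kxy.
have /eqP := f0 x' y'; rewrite mulf_eq0 sqrf_eq0 subr_eq0 => /orP[|/eqP //].
(* On a positive density every edge of [K] keeps a positive conductance, so irreducibility still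
   connects the graph. *)
by rewrite gt_eqF // mulr_gt0 // mulr_gt0 // log_mean_gt0 //; exact: mu_gt0.
Qed.

Lemma segment_potential_flow t : t \in `[0, 1] ->
  flow_at K p mu segment_potential (fun=> rate) t.
Proof.
move=> tI x; have [d1 d2] := segment_derive m0 m1 t x; split => //; rewrite d2.
have source_sum0 : \sum_y w y * source 0 (enum_rank y) = 0.
  under eq_bigr do rewrite mxE enum_rankK mulrBr mulrCA.
  by rewrite sumrB -mulr_sumr p_norm mulr1 subrr.
have := poisson_solution w_ge0 w_sum1 (fun x y => conductance_ge0 x y tI)
  (fun x y => conductance_sym x y tI) (fun f => @harmonic_const t f tI) source_sum0 x.
rewrite [RHS]mxE enum_rankK => e.
have -> : \sum_y (segment_potential t y - segment_potential t x) * hat (mu t) x y * K x y =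
    - (m1 x - m0 x - rate * p x).
  rewrite -e -sumrN; apply: eq_bigr => y _.
  by rewrite -/(segment_potential t x) -/(segment_potential t y) /conductance; ring.
by ring.
Qed.

Lemma segment_hat_continuous t x y : t \in `[0, 1] ->
  {for t, continuous (fun s => hat (mu s) x y)}.
Proof.
move=> tI; apply: log_mean_continuous; try exact: segment_continuous.
- exact: mu_gt0.
- exact: mu_gt0.
Qed.

Lemma segment_potential_continuous t x : t \in `[0, 1] ->
  {for t, continuous (fun s => segment_potential s x)}.
Proof.
move=> tI; apply: continuous_at_cramer; last first.
  apply: det_pinned_laplacian => //.
  - by move=> y z; exact: conductance_ge0.
  - by move=> y z; exact: conductance_sym.
  - by move=> f; exact: harmonic_const.
move=> i j; rewrite (_ : (fun _ => _) = fun s => w (enum_val i) -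
    hat (mu s) (enum_val j) (enum_val i) * K (enum_val j) (enum_val i) +
    (enum_val j == enum_val i)%:R * \sum_z hat (mu s) (enum_val j) z * K (enum_val j) z);
  last by apply/funext => s; rewrite mxE.
have ch y z : {for t, continuous (fun s => hat (mu s) y z * K y z)}.
  by apply: cvgMl; exact: segment_hat_continuous.
apply: cvgD; first by apply: cvgB; [exact: cvg_cst | exact: ch].
by apply: cvgMr; apply: continuous_at_sum => z; exact: ch.
Qed.

Lemma W_positive_lty : (W K w a b p m0 m1 < +oo)%E.
Proof.
have ce : CE K p m0 m1 mu segment_potential (fun=> rate).
  split => //.
  - by move=> t tI x; apply: ltW; exact: mu_gt0.
  - exact: segment_abs_continuous.
  - by move=> x; apply: continuous_measurable01 => t; exact: segment_potential_continuous.
  - by apply: aeW => t; exact: segment_potential_flow.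
  - by apply/funext => x; rewrite /mu /segment mul0r addr0.
  - by apply/funext => x; rewrite /mu /segment mul1r addrC subrK.
have cc : {within `[0, 1], continuous
    (fun t => cost K w a b (mu t) (segment_potential t) rate)}.
  apply: continuous_in_subspaceT => t /set_mem tI.
  apply: cvgD; first exact: cvg_cst.
  do 2 apply: cvgMr; apply: continuous_at_sum => x; apply: continuous_at_sum => y.
  do 2 apply: cvgMl; apply: cvgM; last exact: segment_hat_continuous.
  rewrite (_ : (fun _ => _) = fun s => (segment_potential s y - segment_potential s x) *
    (segment_potential s y - segment_potential s x)); last by apply/funext => s; rewrite expr2.
  by apply: cvgM; apply: cvgB; exact: segment_potential_continuous.
(* The continuous cost attains a maximum on the compact interval, which bounds the action. *)
have [s sI cmax] := EVT_max ler01 cc.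
exact: W_lty ce cmax.
Qed.

End segment_potential.

Lemma W_fin m0 m1 : nonneg_densities m0 -> nonneg_densities m1 ->
  (W K w a b p m0 m1 < +oo)%E.
Proof.
move=> m00 m10.
have pos m : nonneg_densities m -> pos_densities (fun x => m x + p x).
  by move=> mge0 x; rewrite ltr_wpDl //; exact: mge0.
have /le_lt_trans := W_triangle p a b K_ge0 w_ge0 m0 (fun x => m0 x + p x) m1; apply.
apply: lte_add_pinfty; first exact: W_source_lty.
have /le_lt_trans := W_triangle p a b K_ge0 w_ge0
  (fun x => m0 x + p x) (fun x => m1 x + p x) m1; apply.
apply: lte_add_pinfty; first by apply: W_positive_lty; exact: pos.
by rewrite (W_symmetric p a b K_ge0 w_ge0); exact: W_source_lty.
Qed.

Lemma W_refl m : nonneg_densities m -> W K w a b p m m = 0%E.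
Proof.
move=> m0; apply/eqP; rewrite eq_le sqrte_ge0 andbT.
have ce : CE K p m m (fun=> m) (fun _ _ => 0) (fun=> 0).
  split => //.
  - by move=> x; exact: abs_continuous_on_cst.
  - apply: aeW => t _ x; split; first exact: derivable_cst.
    rewrite derive1_cst big1 ?addr0 ?mul0r // => y _.
    by rewrite subrr !mul0r.
apply: (W_le ce (lexx 0)); rewrite (action_cost a b K_ge0 w_ge0 ce) expr0n /=.
rewrite integral0_eq // => t _; rewrite /cost expr0n /= mulr0 add0r.
rewrite big1 ?mulr0 // => x _; rewrite big1 // => y _.
by rewrite subrr expr0n /= !mul0r.
Qed.

End finiteness.

Theorem theorem3p10 (R : realType) (X : finType) (K : X -> X -> R)
    (w : X -> R) (a b : R) (p : X -> R)
    (K_markov : markov_kernel K)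
    (K_irreducible : irreducible_kernel K)
    (w_steady : steady_state K w)
    (w_reversible : reversible_for K w)
    (a_gt0 : 0 < a) (b_gt0 : 0 < b)
    (p_pos : pos_densities p)
    (p_norm : weighted_norm1 w p = 1) :
  [/\ forall mu0 mu1, nonneg_densities mu0 -> nonneg_densities mu1 ->
        (0 <= W K w a b p mu0 mu1)%E /\ (W K w a b p mu0 mu1 < +oo)%E,
      forall mu0 mu1, nonneg_densities mu0 -> nonneg_densities mu1 ->
        W K w a b p mu0 mu1 = W K w a b p mu1 mu0,
      forall mu0 mu1 mu2, nonneg_densities mu0 -> nonneg_densities mu1 ->
        nonneg_densities mu2 ->
        (W K w a b p mu0 mu2 <= W K w a b p mu0 mu1 + W K w a b p mu1 mu2)%E
    & forall mu0 mu1, nonneg_densities mu0 -> nonneg_densities mu1 ->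
        (W K w a b p mu0 mu1 = 0%E <-> mu0 = mu1)].
Proof.
have [K_ge0 K_sum1] := K_markov; have [w_ge0 _ w_sum1] := w_steady.
have w_gt0 x : 0 < w x by exact: (steady_state_gt0 x K_ge0 K_irreducible w_steady).
have wp1 : \sum_(x : X) w x * p x = 1.
  by rewrite -p_norm; apply: eq_bigr => x _; rewrite gtr0_norm.
split.
- by move=> mu0 mu1 mu00 mu10; split; [exact: sqrte_ge0 | exact: W_fin].
- by move=> mu0 mu1 _ _; exact: W_symmetric.
- by move=> mu0 mu1 mu2 _ _ _; exact: W_triangle.
- move=> mu0 mu1 mu00 _; split; first exact: W_eq0_eq.
  by move=> <-; exact: W_refl.
Qed.
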